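(* Let $n\ge 3$. The number of self-dual isomorphism classes of semirigid $3$-nilpotent semigroups of cardinality $n$ is at most $$D_n=\sum_{r=1}^{n-2}\ \sum_{\lambda\vdash r}\frac{1}{w(\lambda)}\sum_{j=0}^{\zeta(\lambda)}\binom{\zeta(\lambda)}{j}\sum_{t=0}^{\min\{j,\lfloor (n-r-1)/2\rfloor\}} a_{j,t}\left\{ {\zeta(\lambda)+\eta(\lambda)-j+1 \atop n-r-2t} \right\},$$ and $D_n$ is also at most the number of self-dual isomorphism classes of all $3$-nilpotent semigroups of cardinality $n$.
   Context: A semigroup $S$ is $3$-nilpotent if it is finite, has a zero $0$, satisfies $xyz=0$ for all $x,y,z$, and $ab\ne0$ for some $a,b$. $S$ is semirigid if every automorphism of $S$ fixes every element of $S^2$. The dual $S^*$ of $S$ has the same carrier with product $x*y=yx$; $S$ is self-dual if $S\cong S^*$ (an isomorphism class is self-dual if its members are). $\left\{ {a \atop b} \right\}$ is the Stirling number of the second kind, with $\left\{ {0 \atop 0} \right\}=1$ and value $0$ if $b>a$ or ($b=0<a$). $a_{j,t}=2^{j-t}\left\{ {j \atop t} \right\}$. For $\lambda\vdash r$ with parts listed with repetition as $\lambda_1,\dots,\lambda_s$: $e_i=1$ if $\lambda_i$ is even, else $0$; $f_i=1$ if $\lambda_i\equiv2\pmod4$, else $0$; $e_{ij}=1$ if at least one of $\lambda_i,\lambda_j$ is even, else $0$; $$\zeta(\lambda)=\tfrac12\sum_{i=1}^{s}\big((1+e_i)(\lambda_i+1)-2(f_i+1)\big)+\sum_{1\le i<j\le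 s}(1+e_{ij})\gcd(\lambda_i,\lambda_j),\qquad \eta(\lambda)=\sum_{i=1}^{s}(1-e_i+2f_i).$$ If the distinct part sizes are $\ell_1,\dots,\ell_q$ with multiplicities $\mu_1,\dots,\mu_q$, $w(\lambda)=\ell_1^{\mu_1}\cdots\ell_q^{\mu_q}\mu_1!\cdots\mu_q!$. *)

(* Defs.v *)
From mathcomp Require Import all_boot all_order all_algebra all_fingroup.
From mathcomp Require Import zify ring.

Set Implicit Arguments.
Unset Strict Implicit.
Unset Printing Implicit Defensive.

Import Order.TTheory GRing.Theory Num.Theory.

(* Binary operations on a carrier with n elements; every semigroup of
   cardinality n is isomorphic to one whose carrier is 'I_n. *)
Definition binop (n : nat) := {ffun 'I_n * 'I_n -> 'I_n}.

Section Semigroups.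
Variable n : nat.
Implicit Types (m : binop n) (s : {perm 'I_n}).

Definition semigroup m : bool :=
  [forall x, forall y, forall z, m (m (x, y), z) == m (x, m (y, z))].

Definition is_zero m (o : 'I_n) : bool :=
  [forall x, (m (o, x) == o) && (m (x, o) == o)].

Definition nilpotent3 m : bool :=
  semigroup m &&
  [exists o, [&& is_zero m o,
                 [forall x, forall y, forall z, m (m (x, y), z) == o] &
                 [exists a, exists b, m (a, b) != o]]].

Definition is_iso m1 m2 s : bool :=
  [forall x, forall y, s (m1 (x, y)) == m2 (s x, s y)].

Definition isomorphic : rel (binop n) :=
  fun m1 m2 => [exists s, is_iso m1 m2 s].

Definition semirigid m : bool :=
  [forall s, is_iso m m s ==> [forall x, forall y, s (m (x, y)) == m (x, y)]].

Definition dual m : binop n := [ffun p => m (p.2, p.1)].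

Definition self_dual m : bool := isomorphic m (dual m).

Definition iso_classes (P : pred (binop n)) : {set {set binop n}} :=
  equivalence_partition isomorphic [set m | P m].

Definition self_dual_classes (P : pred (binop n)) : {set {set binop n}} :=
  [set C in iso_classes P | [forall m in C, self_dual m]].

End Semigroups.

Definition stirling2 (a b : nat) : nat :=
  #|[set P : {set {set 'I_a}} | partition P [set: 'I_a] & #|P| == b]|.

Definition acoef (j t : nat) : nat := 2 ^ (j - t) * stirling2 j t.

(* Every partition of r has at most r parts, each of them at most r, so the
   partitions of r all live in the finite type {bseq r of 'I_r.+1}. *)
Definition is_partition (r : nat) (l : seq nat) : bool :=
  [&& sorted geq l, all (leq 1) l & sumn l == r].

Definition parts (r : nat) (l : {bseq r of 'I_r.+1}) : seq nat :=
  [seq val i | i <- l].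

Section PartitionStatistics.
Variable l : seq nat.
Local Notation part i := (nth 0 l i).

Definition epart (i : nat) : nat := ~~ odd (part i).
Definition fpart (i : nat) : nat := part i %% 4 == 2.
Definition epart2 (i j : nat) : nat := ~~ odd (part i) || ~~ odd (part j).

(* The truncated subtractions and the halving are exact on positive parts:
   see zetaE and etaE. *)
Definition zeta : nat :=
  (\sum_(i < size l)
     ((1 + epart i) * (part i + 1) - 2 * (fpart i + 1))) %/ 2
  + \sum_(i < size l) \sum_(j < size l | i < j)
      (1 + epart2 i j) * gcdn (part i) (part j).

Definition eta : nat := \sum_(i < size l) (1 - epart i + 2 * fpart i).

Definition wpart : nat :=
  \prod_(k <- undup l) (k ^ count_mem k l * (count_mem k l)`!).

Local Open Scope ring_scope.

Lemma zetaE : all (leq 1) l ->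
  zeta%:R = 1 / 2 * (\sum_(i < size l)
      ((1 + (epart i)%:R) * ((part i)%:R + 1) - 2 * ((fpart i)%:R + 1)))
    + \sum_(i < size l) \sum_(j < size l | (i < j)%N)
        (1 + (epart2 i j)%:R) * (gcdn (part i) (part j))%:R :> rat.
Proof.
move=> l_gt0; rewrite /zeta natrD; congr (_ + _); last first.
  rewrite natr_sum; apply: eq_bigr => i _; rewrite natr_sum.
  by apply: eq_bigr => j _; rewrite natrM natrD.
pose F i := ((1 + epart i) * (part i + 1) - 2 * (fpart i + 1))%N.
have Fle (i : 'I_(size l)) :
    (2 * (fpart i + 1) <= (1 + epart i) * (part i + 1))%N.
  have := all_nthP 0%N l_gt0 i (ltn_ord i).
  rewrite /epart /fpart; case: eqP; case: (boolP (odd _)) => /=; nia.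
have F2 (i : 'I_(size l)) : (2 %| F i)%N.
  rewrite /F /epart; case: (boolP (odd _)) => /=; lia.
rewrite -(big_mkord xpredT F).
have dv : (2 %| \sum_(0 <= i < size l) F i)%N.
  by rewrite big_mkord; apply: dvdn_sum => i _; exact: F2.
have -> : (\sum_(i < size l)
      ((1 + (epart i)%:R) * ((part i)%:R + 1) - 2 * ((fpart i)%:R + 1)))
    = (\sum_(0 <= i < size l) F i)%:R :> rat.
  rewrite big_mkord natr_sum; apply: eq_bigr => i _.
  by rewrite /F natrB ?Fle // !natrM !natrD.
rewrite -{2}(divnK dv) natrM; by field.
Qed.

Lemma etaE :
  eta%:R = \sum_(i < size l) (1 - (epart i)%:R + 2 * (fpart i)%:R) :> rat.
Proof.
rewrite natr_sum; apply: eq_bigr => i _.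
by rewrite natrD natrM natrB // /epart leq_b1.
Qed.

End PartitionStatistics.

Local Open Scope ring_scope.

Definition Dbound (n : nat) : rat :=
  \sum_(1 <= r < (n - 2).+1)
   \sum_(l : {bseq r of 'I_r.+1} | is_partition r (parts l))
    (wpart (parts l))%:R^-1 *
    \sum_(0 <= j < (zeta (parts l)).+1)
      'C(zeta (parts l), j)%:R *
      \sum_(0 <= t < (minn j ((n - r - 1) %/ 2)).+1)
        (acoef j t)%:R *
        (stirling2 (zeta (parts l) + eta (parts l) - j + 1)
                   (n - r - 2 * t))%:R.

(* Main.v *)
(**
A 3-nilpotent semigroup is given by [A], the complement of [S^2], its zero [o],
and a map [f : A * A -> ~: A] covering everything but possibly [o]. By a twisted
Burnside argument, the number of self-dual isomorphism classes in an
isomorphism-invariant class is the number of pairs (semigroup, anti-automorphism)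
divided by [n!]. If [s] is an anti-automorphism, then [s * s] is an automorphism,
so in the semirigid case [s] restricts to an involution of [S^2]. Hence it
suffices to show that [n! * Dbound n] counts the pairs for which [s] is
involutive on [S^2]: it bounds the semirigid pairs from above, and is bounded by
the number of all pairs.

For such a pair let [g] and [h] be the restrictions of [s] to [A] and [S^2];
then [f] intertwines [(x, y) |-> (g y, g x)] with the involution [h]. On an orbit
of the former, [f] is determined by one value, which is arbitrary if the orbit
has even length, and must be fixed by [h] if the length is odd. There are
[zeta] even and [eta] odd orbits, where [zeta] and [eta] are evaluated at the
cycle type of [g]. Choosing the [j] even orbits sent to 2-cycles of [h], and
counting surjections, gives the inner sums; the sum over [g] produces the
weights [1 / w(lambda)].
*)

Require Import Defs.
From mathcomp Require Import all_boot all_order all_algebra all_fingroup.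
From mathcomp Require Import zify ring.

Set Implicit Arguments.
Unset Strict Implicit.
Unset Printing Implicit Defensive.

Import Order.TTheory GRing.Theory Num.Theory.

(** * Counting self-dual classes by anti-automorphisms *)

Section TwistedBurnside.
Variable n : nat.
Implicit Types (m : binop n) (s t : {perm 'I_n}).

Definition transport s m : binop n :=
  [ffun p => s (m ((s^-1)%g p.1, (s^-1)%g p.2))].

Lemma is_isoP m1 m2 s :
  reflect (forall x y, s (m1 (x, y)) = m2 (s x, s y)) (is_iso m1 m2 s).
Proof. by apply: 'forall_'forall_eqP. Qed.

Lemma is_isoE m1 m2 s : is_iso m1 m2 s = (m2 == transport s m1).
Proof.
apply/is_isoP/eqP => [h | -> x y]; last by rewrite ffunE !permK.
by apply/ffunP=> -[x y]; rewrite ffunE h !permKV.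
Qed.

Lemma is_iso1 m : is_iso m m 1%g.
Proof. by apply/is_isoP => x y; rewrite !perm1. Qed.

Lemma is_isoM m1 m2 m3 s t :
  is_iso m1 m2 s -> is_iso m2 m3 t -> is_iso m1 m3 (s * t)%g.
Proof.
move=> /is_isoP h1 /is_isoP h2; apply/is_isoP => x y.
by rewrite !permM h1 h2.
Qed.

Lemma is_isoV m1 m2 s : is_iso m1 m2 s -> is_iso m2 m1 (s^-1)%g.
Proof.
move=> /is_isoP h; apply/is_isoP => x y.
by apply: (@perm_inj _ s); rewrite h !permKV.
Qed.

Lemma is_iso_dual m1 m2 s : is_iso m1 m2 s -> is_iso (dual m1) (dual m2) s.
Proof.
by move=> /is_isoP h; apply/is_isoP => x y; rewrite !ffunE h.
Qed.

Lemma isomorphic_equiv : equivalence_rel (@isomorphic n).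
Proof.
move=> m1 m2 m3; split; first by apply/existsP; exists 1%g; apply: is_iso1.
move=> /existsP[s hs]; apply/existsP/existsP => -[t ht].
  by exists (s^-1 * t)%g; apply: is_isoM ht; apply: is_isoV.
by exists (s * t)%g; apply: is_isoM hs ht.
Qed.

Lemma card_isos_target m m1 m2 s :
  is_iso m1 m2 s -> #|[set t | is_iso m m1 t]| = #|[set t | is_iso m m2 t]|.
Proof.
move=> hs; rewrite -(card_imset _ (mulIg s)); apply: eq_card => t.
rewrite inE; apply/imsetP/idP => [[u]|ht].
  by rewrite inE => hu ->; apply: is_isoM hu hs.
exists (t * s^-1)%g; last by rewrite mulgKV.
by rewrite inE; apply: is_isoM ht _; apply: is_isoV.
Qed.

Lemma card_isos_source m m1 m2 s :
  is_iso m1 m2 s -> #|[set t | is_iso m1 m t]| = #|[set t | is_iso m2 m t]|.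
Proof.
move=> hs; rewrite -(card_imset _ (mulgI s^-1%g)); apply: eq_card => t.
rewrite inE; apply/imsetP/idP => [[u]|ht].
  by rewrite inE => hu ->; apply: is_isoM hu; apply: is_isoV.
exists (s * t)%g; last by rewrite mulKg.
by rewrite inE; apply: is_isoM hs ht.
Qed.

Definition iso_invariant (P : pred (binop n)) :=
  forall m1 m2 s, is_iso m1 m2 s -> P m1 -> P m2.

Variable P : pred (binop n).
Hypothesis P_inv : iso_invariant P.

(** For [m] in the class of the self-dual [x], all of [m], [dual m], [x] and [dual x] are
    isomorphic, so there are as many isomorphisms from [m] to [dual m] as from [x] to [m]. Every
    permutation is an isomorphism from [x] to exactly one [m], hence the total [n!]. *)
Lemma sum_antiisos_class x : P x -> self_dual x ->
  \sum_(m | P m && isomorphic x m) #|[set s | is_iso m (dual m) s]| = n`!.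
Proof.
move=> Px /existsP[d hd].
transitivity (\sum_(m | P m && isomorphic x m) #|[set s | is_iso x m s]|).
  apply: eq_bigr => m /andP[Pm /existsP[s hs]].
  rewrite -(card_isos_source _ hs) -(card_isos_target _ (is_iso_dual hs)).
  by rewrite -(card_isos_target _ hd) (card_isos_target _ hs).
have <- : #|{: {perm (ordinal n)}}| = n`! by rewrite -card_Sn; apply: eq_card.
rewrite -sum1_card (partition_big (fun s => transport s x)
  (fun m => P m && isomorphic x m)) /=; last first.
  move=> s _; have hs : is_iso x (transport s x) s by rewrite is_isoE.
  by rewrite (P_inv hs) //; apply/existsP; exists s.
apply: eq_bigr => m _; rewrite -sum1_card; apply: eq_bigl => s.
by rewrite !inE is_isoE eq_sym.
Qed.

(** A self-dual class contributes [n!] by [sum_antiisos_class]. Any other class contributes 0,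
    because a single anti-automorphism in it would make all its members self-dual. *)
Lemma card_self_dual_classes :
  #|self_dual_classes P| * n`!
  = \sum_(m | P m) #|[set s | is_iso m (dual m) s]|.
Proof.
pose D := [set m | P m].
have eqvD : {in D & &, equivalence_rel (@isomorphic n)}.
  by move=> x y z _ _ _; apply: isomorphic_equiv.
have partD := equivalence_partitionP eqvD.
rewrite (eq_bigl (mem D)) => [|m]; last by rewrite !inE.
rewrite (set_partition_big _ partD) /= -sum_nat_const.
rewrite big_mkcond [RHS]big_mkcond; apply: eq_bigr => C _ /=.
rewrite inE; case: ifPn => [/andP[CP /forallP sdC]|].
  rewrite CP; case/imsetP: CP sdC => x; rewrite inE => Px -> sdC.
  rewrite -(@sum_antiisos_class x) //.
    by apply: eq_bigl => m; rewrite !inE.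
  have /implyP := sdC x; apply; rewrite !inE Px.
  by case: (isomorphic_equiv x x x).
case: ifP => //= CP; rewrite negb_forall_in => /exists_inP[y yC nsdy].
symmetry; apply: big1 => m mC; apply: eq_card0 => s; rewrite inE.
apply: contraNF nsdy => hs.
case/imsetP: CP yC mC => x _ ->; rewrite !inE.
move=> /andP[_ hxy] /andP[_ hxm].
have /existsP[t ht] : isomorphic m y.
  by case: (isomorphic_equiv x m y) => _ <-.
(* Conjugated by [t], the anti-automorphism [s] of [m] becomes one of [y]. *)
apply/existsP; exists (t^-1 * s * t)%g.
apply: is_isoM (is_iso_dual ht); apply: is_isoM hs; exact: is_isoV.
Qed.

End TwistedBurnside.

(** * Invariance of the two semigroup properties under isomorphism *)

Section Invariance.
Variable n : nat.

Lemma nilpotent3_inv : iso_invariant (@nilpotent3 n).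
Proof.
move=> m1 m2 s /is_isoV; set t := (s^-1)%g => /is_isoP h.
case/andP=> /'forall_'forall_'forall_eqP sg /existsP[o].
case/and3P=> /forallP o0 /'forall_'forall_'forall_eqP nil3.
move=> /existsP[a /existsP[b ab]].
apply/andP; split.
  apply/'forall_'forall_'forall_eqP => x y z; apply: (@perm_inj _ t).
  by rewrite !h sg.
have tK x : t (s x) = x by rewrite permK.
apply/existsP; exists (s o); apply/and3P; split.
- apply/forallP => x; have /andP[/eqP o1 /eqP o2] := o0 (t x).
  by apply/andP; split; apply/eqP/(@perm_inj _ t); rewrite h !tK.
- apply/'forall_'forall_'forall_eqP => x y z; apply: (@perm_inj _ t).
  by rewrite !h nil3 tK.
apply/existsP; exists (s a); apply/existsP; exists (s b).
apply: contra ab => /eqP/(congr1 t); rewrite h !tK => ->; exact: eqxx.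
Qed.

(** Conjugation by [s] turns an automorphism of [m2] into one of [m1], which fixes all products of
    [m1]; [s] carries these to the products of [m2]. *)
Lemma semirigid_inv : iso_invariant (@semirigid n).
Proof.
move=> m1 m2 s hs /forallP rig; apply/forallP => t; apply/implyP => ht.
have /implyP := rig (s * t * s^-1)%g; case/(_ _)/Wrap.
  by apply: is_isoM (is_isoV hs); apply: is_isoM hs ht.
move=> /'forall_'forall_eqP fx.
have /is_isoP hV := is_isoV hs.
apply/'forall_'forall_eqP => x y; have := fx (s^-1 x)%g (s^-1 y)%g.
by rewrite -hV !permM permKV => /perm_inj.
Qed.

End Invariance.

(** * Weighted sums over integer partitions *)

(** Plain lists are used because recursion on [r] would change the type [{bseq r of 'I_r.+1}]. *)
Definition partitions (r : nat) : seq (seq nat) :=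
  [seq parts l | l <- enum {: {bseq r of 'I_r.+1}} & is_partition r (parts l)].

Lemma size_le_sumn (l : seq nat) : all (leq 1) l -> size l <= sumn l.
Proof. by elim: l => //= a l IH /andP[a0 /IH]; lia. Qed.

Lemma mem_le_sumn (l : seq nat) i : i \in l -> i <= sumn l.
Proof. by elim: l => //= a l IH; rewrite inE => /orP[/eqP->|/IH]; lia. Qed.

Lemma mem_partitions r l : (l \in partitions r) = is_partition r l.
Proof.
apply/mapP/idP => [[b] | lP]; first by rewrite mem_filter => /andP[bP _] ->.
have /and3P[_ l0 /eqP lr] := lP.
have sz : size [seq (inord i : 'I_r.+1) | i <- l] <= r.
  by rewrite size_map -[X in _ <= X]lr size_le_sumn.
have lE : l = parts (Bseq sz).
  rewrite /parts /= -map_comp map_id_in // => i /mem_le_sumn il /=.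
  by rewrite inordK // -lr.
by exists (Bseq sz) => //; rewrite mem_filter -lE lP mem_enum.
Qed.

Lemma partitions_uniq r : uniq (partitions r).
Proof.
rewrite map_inj_uniq; first by rewrite filter_uniq // enum_uniq.
by move=> b1 b2 /(inj_map val_inj)/val_inj.
Qed.

Lemma sum_partitions (R : nmodType) r (G : seq nat -> R) :
  (\sum_(l : {bseq r of 'I_r.+1} | is_partition r (parts l)) G (parts l)
   = \sum_(l <- partitions r) G l)%R.
Proof. by rewrite big_map big_filter big_enum_cond. Qed.

Definition insert_part (k : nat) (l : seq nat) := sort geq (k :: l).

Lemma geq_total : total geq.
Proof. by move=> a b; apply: leq_total. Qed.

Lemma geq_trans : transitive geq.
Proof. by move=> a b c ba ac; apply: leq_trans ac ba. Qed.

Lemma geq_anti : antisymmetric geq.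
Proof. by move=> a b; rewrite andbC => /anti_leq. Qed.

Lemma sort_geq_eq (l1 l2 : seq nat) :
  perm_eq l1 l2 -> sort geq l1 = sort geq l2.
Proof. by move/(perm_sortP geq_total geq_trans geq_anti). Qed.

Lemma perm_insert k l : perm_eq (insert_part k l) (k :: l).
Proof. by rewrite /insert_part perm_sort. Qed.

Lemma is_partition_insert k r l : 0 < k <= r ->
  is_partition r (insert_part k l) =
  is_partition (r - k) (sort geq l).
Proof.
move=> /andP[k0 kr].
rewrite /is_partition /insert_part !(sort_sorted geq_total) !all_sort /= k0 /=.
rewrite (perm_sumn (perm_insert k l)) /= (perm_sumn (_ : perm_eq _ l)) ?perm_sort //.
congr (_ && _); apply/eqP/eqP; lia.
Qed.

(** Up to sorting, inserting [k] is undone by removing one copy of [k]. *)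
Lemma partitions_with_part k r : 0 < k <= r ->
  perm_eq [seq l <- partitions r | k \in l]
          [seq insert_part k l | l <- partitions (r - k)].
Proof.
move=> kr; apply: uniq_perm.
- by rewrite filter_uniq ?partitions_uniq.
- rewrite map_inj_in_uniq ?partitions_uniq // => l1 l2.
  rewrite !mem_partitions => /and3P[s1 _ _] /and3P[s2 _ _] e.
  apply: (sorted_eq geq_trans geq_anti s1 s2).
  rewrite -(perm_cons k) -(permPl (perm_insert k l1)) e; exact: perm_insert.
move=> l; rewrite mem_filter mem_partitions; apply/andP/mapP.
  move=> [kl lP]; have ls : sorted geq l by case/and3P: lP.
  have e : insert_part k (sort geq (rem k l)) = l.
    apply: (sorted_eq geq_trans geq_anti) => //; first exact: sort_sorted geq_total _.
    rewrite (permPl (perm_insert _ _)) perm_sym.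
    by rewrite (permPl (perm_to_rem kl)) perm_cons perm_sym perm_sort.
  exists (sort geq (rem k l)) => //; rewrite mem_partitions.
  rewrite -(sorted_sort geq_trans (_ : sorted geq (sort geq (rem k l)))).
    by rewrite -is_partition_insert // e.
  exact: sort_sorted geq_total _.
move=> [l']; rewrite mem_partitions => lP ->; split.
  by rewrite (perm_mem (perm_insert k l')) mem_head.
rewrite is_partition_insert // sorted_sort //; last by case/and3P: lP.
exact: geq_trans.
Qed.

(** Indices outside [l] have multiplicity 0 and contribute the factor 1. The weights of two
    partitions can thus be compared over one index set. *)
Lemma wpartE (l s : seq nat) : uniq s -> {subset l <= s} ->
  wpart l = \prod_(k <- s) (k ^ count_mem k l * (count_mem k l)`!).
Proof.
move=> us ls; rewrite /wpart [RHS](bigID (mem l)) /=.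
rewrite [X in (_ * X)%N]big1 ?muln1 => [|i /count_memPn ->]; last by [].
rewrite -[RHS]big_filter; apply: perm_big; apply: uniq_perm.
- exact: undup_uniq.
- exact: filter_uniq.
move=> i; rewrite mem_undup mem_filter /=.
by case: (boolP (i \in l)) => //= /ls.
Qed.

Lemma wpart_insert k l : wpart (insert_part k l) = k * (count_mem k l).+1 * wpart l.
Proof.
pose s := undup (k :: l).
have us : uniq s by apply: undup_uniq.
have ks : k \in s by rewrite mem_undup mem_head.
rewrite (@wpartE (insert_part k l) s) //; last first.
  by move=> i; rewrite (perm_mem (perm_insert k l)) mem_undup.
rewrite (@wpartE l s) //; last first.
  by move=> i il; rewrite mem_undup inE il orbT.
rewrite !(bigD1_seq k ks us) /= (seq.permP (perm_insert k l)) /= eqxx add1n.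
under eq_bigr => i ik.
  by rewrite (seq.permP (perm_insert k l)) /= (negbTE (_ : k != i)) 1?eq_sym // over.
by rewrite factS expnS; move: (_ ^ _)%N (_`!) (\prod_(_ <- _ | _) _)%N => a b c; ring.
Qed.

Lemma sumn_count (l : seq nat) :
  sumn l = \sum_(k <- undup l) k * count_mem k l.
Proof.
rewrite sumnE.
transitivity (\sum_(i <- l) \sum_(k <- undup l) k * (i == k)).
  rewrite big_seq_cond [RHS]big_seq_cond; apply: eq_bigr => i /andP[il _].
  rewrite (bigD1_seq i) ?mem_undup ?undup_uniq //= eqxx muln1 big1 ?addn0 //.
  by move=> k; rewrite eq_sym => /negbTE ->; rewrite muln0.
rewrite exchange_big; apply: eq_bigr => k _ /=.
rewrite -big_distrr /=; congr (_ * _)%N; rewrite -sum1_count [RHS]big_mkcond.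
by apply: eq_bigr => i _; rewrite /=; case: (i == k).
Qed.

Section PartitionSums.
Local Open Scope ring_scope.

(** As [r! / wpart l] permutations of [r] points have cycle type [l], this is the mean of [F] over
    their cycle types; see [sum_perm_cycle_type]. *)
Definition partition_sum (r : nat) (F : seq nat -> rat) : rat :=
  \sum_(l <- partitions r) F l / (wpart l)%:R.

Lemma partition_sum0 F : partition_sum 0 F = F [::].
Proof.
rewrite /partition_sum (perm_big [:: [::]]) /=.
  by rewrite big_seq1 /wpart big_nil divr1.
apply: uniq_perm => //; first exact: partitions_uniq.
move=> l; rewrite mem_partitions inE; case: l => // a l.
by rewrite /is_partition /=; case: a => [|a]; rewrite !(andbF, addSn).
Qed.

Lemma partition_sum_ext r F G : F =1 G -> partition_sum r F = partition_sum r G.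
Proof. by move=> FG; apply: eq_bigr => l _; rewrite FG. Qed.

(** Write [r] as the sum of [k * count_mem k l] over the part sizes [k] of [l] and exchange the
    sums. The partitions containing [k] arise by inserting [k], and [wpart_insert] cancels the
    factor [k * count_mem k l]. *)
Lemma partition_sum_rec r F :
  r%:R * partition_sum r F =
  \sum_(1 <= k < r.+1) partition_sum (r - k) (F \o insert_part k).
Proof.
pose H k l : rat := (k * count_mem k l)%:R * (F l / (wpart l)%:R).
transitivity (\sum_(l <- partitions r) \sum_(1 <= k < r.+1 | k \in l) H k l).
  rewrite /partition_sum mulr_sumr big_seq [RHS]big_seq.
  apply: eq_bigr => l; rewrite mem_partitions => lP.
  have /and3P[_ l0 /eqP lr] := lP.
  rewrite -{1}lr sumn_count natr_sum mulr_suml -[RHS]big_filter.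
  apply: perm_big; apply: uniq_perm.
  - exact: undup_uniq.
  - by rewrite filter_uniq ?iota_uniq.
  move=> k; rewrite mem_undup mem_filter mem_index_iota andbC /=.
  case: (boolP (k \in l)) => //= kl; last by rewrite andbF.
  by rewrite andbT -lr ltnS mem_le_sumn // (allP l0).
rewrite (exchange_big_dep xpredT) //= big_nat [RHS]big_nat.
apply: eq_bigr => k kr.
rewrite -big_filter (perm_big _ (partitions_with_part _)) //= big_map.
apply: eq_bigr => l _; rewrite /H /= wpart_insert (seq.permP (perm_insert k l)) /=.
rewrite eqxx add1n (natrM _ (k * _)%N) invfM mulrCA; congr (_ * _).
by rewrite mulrA mulfV ?mul1r // pnatr_eq0 muln_eq0 /=; lia.
Qed.

End PartitionSums.

(** * Sums over permutations by cycle type *)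

Section PermSums.
Variable T : finType.
Implicit Types (A C D : {set T}) (g c d s t : {perm T}).

Lemma eq_porbit_on (X : {set T}) s t x :
  {in X, s =1 t} -> (forall y, y \in X -> t y \in X) -> x \in X ->
  porbit s x = porbit t x.
Proof.
move=> st tX xX.
have e i : (s ^+ i)%g x = (t ^+ i)%g x /\ (t ^+ i)%g x \in X.
  elim: i => [|i [e1 e2]]; first by rewrite !expg0 !perm1.
  by rewrite !expgSr !permM e1 (st _ e2); split=> //; apply: tX.
apply/setP => y; apply/porbitP/porbitP => -[i ->]; exists i; case: (e i) => //.
Qed.

Lemma porbit_sub (X : {set T}) t x :
  (forall y, y \in X -> t y \in X) -> x \in X -> porbit t x \subset X.
Proof.
move=> tX xX; apply/subsetP => y /porbitP[i ->].
elim: i => [|i IH]; first by rewrite expg0 perm1.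
by rewrite expgSr permM; apply: tX.
Qed.

Lemma imset_perm_sub (X : {set T}) g x : g @: X = X -> x \in X -> g x \in X.
Proof. by move=> gX xX; rewrite -gX imset_f. Qed.

Lemma imset_porbit g x : g @: porbit g x = porbit g x.
Proof.
apply/eqP; rewrite eqEcard card_imset ?leqnn; last exact: perm_inj.
rewrite andbT; apply/subsetP => _ /imsetP[y /porbitP[i ->] ->].
by rewrite -permM -expgSr mem_porbit.
Qed.

Lemma restr_perm_imset (X : {set T}) g x :
  g @: X = X -> x \in X -> restr_perm X g x = g x.
Proof.
move=> gX xX; rewrite restr_permE //; apply/astabsP => y.
rewrite /= /aperm; apply/idP/idP; last exact: imset_perm_sub.
by rewrite -{1}gX => /imsetP[z zX /perm_inj ->].
Qed.

Lemma mul_permL (X Y : {set T}) c d x : [disjoint X & Y] ->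
  perm_on X c -> perm_on Y d -> x \in X -> (c * d)%g x = c x.
Proof.
move=> XY cX dY xX; rewrite permM (out_perm dY) //.
by rewrite (disjointFr XY) // (perm_closed _ cX).
Qed.

Lemma mul_permR (X Y : {set T}) c d x : [disjoint X & Y] ->
  perm_on X c -> perm_on Y d -> x \in Y -> (c * d)%g x = d x.
Proof.
by move=> XY cX dY xY; rewrite permM (out_perm cX) // (disjointFl XY).
Qed.

(** A permutation of [X :|: Y] that preserves [X] also preserves [Y], so it is the product of its
    two restrictions, and in only one way. *)
Lemma sum_perm_split (R : nmodType) (X Y : {set T}) (G : {perm T} -> R) :
  [disjoint X & Y] ->
  (\sum_(g | perm_on (X :|: Y) g && (g @: X == X)) G g
   = \sum_(c | perm_on X c) \sum_(d | perm_on Y d) G (c * d)%g)%R.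
Proof.
move=> XY; rewrite pair_big /=.
rewrite (reindex_onto (fun p : {perm T} * {perm T} => (p.1 * p.2)%g)
   (fun g => (restr_perm X g, restr_perm Y g))) /=.
  apply: eq_bigl => -[c d] /=; apply/idP/idP; last first.
    move=> /andP[cX dY]; rewrite perm_onM; last first.
    - by apply: subset_trans dY _; apply: subsetUr.
    - by apply: subset_trans cX _; apply: subsetUl.
    have cdX : (c * d)%g @: X = X.
      rewrite -[RHS](im_perm_on cX); apply: eq_in_imset => x xX.
      exact: mul_permL XY cX dY xX.
    have cdY : (c * d)%g @: Y = Y.
      rewrite -[RHS](im_perm_on dY); apply: eq_in_imset => x xY.
      exact: mul_permR XY cX dY xY.
    rewrite cdX eqxx /=; apply/eqP; congr (_, _); apply/permP => x.
      case: (boolP (x \in X)) => xX.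
        by rewrite restr_perm_imset // (mul_permL XY cX dY).
      by rewrite !(out_perm _ xX) // restr_perm_on.
    case: (boolP (x \in Y)) => xY.
      by rewrite restr_perm_imset // (mul_permR XY cX dY).
    by rewrite !(out_perm _ xY) // restr_perm_on.
  by move=> /andP[_ /eqP[<- <-]]; rewrite !restr_perm_on.
move=> g /andP[gXY /eqP gX].
have gY : g @: Y = Y.
  apply/eqP; rewrite eqEcard card_imset ?leqnn ?andbT; last exact: perm_inj.
  apply/subsetP => _ /imsetP[y yY ->].
  have : g y \in X :|: Y by rewrite (perm_closed _ gXY) inE yY orbT.
  rewrite inE => /orP[|//]; rewrite -{1}gX => /imsetP[z zX /perm_inj e].
  by move: zX; rewrite -e (disjointFl XY).
apply/permP => x; case: (boolP (x \in X)) => xX.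
  by rewrite (mul_permL XY) ?restr_perm_on // restr_perm_imset.
case: (boolP (x \in Y)) => xY.
  by rewrite (mul_permR XY) ?restr_perm_on // restr_perm_imset.
rewrite permM (out_perm (restr_perm_on X g) xX) (out_perm (restr_perm_on Y g) xY).
by rewrite (out_perm gXY) // inE negb_or xX.
Qed.

Lemma disjoint_setD C A : [disjoint C & A :\: C].
Proof. by rewrite -setI_eq0; apply/eqP/setP => x; rewrite !inE; case: (x \in C). Qed.

(** Fixed points inside [A] count as parts 1 and points outside [A] do not count, so for [g]
    supported on [A] this is a partition of [#|A|]. *)
Definition cycle_type A g : seq nat :=
  sort geq [seq #|pred_of_set C| | C <- enum (porbit g @: A)].

(** For [a] in [C] these are the permutations that run through [C] in one full cycle. *)
Definition cyclic_perms C a : {set {perm T}} :=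
  [set c | perm_on C c && (porbit c a == C)].

(** The orbits of [c * d] in [A] are [C] and the orbits of [d] in [A :\: C]. As [C] is not among the
    latter, exactly one part is added. *)
Lemma cycle_type_mul A C c d a : a \in C -> C \subset A ->
  c \in cyclic_perms C a -> perm_on (A :\: C) d ->
  cycle_type A (c * d)%g = insert_part #|C| (cycle_type (A :\: C) d).
Proof.
move=> aC CA; rewrite inE => /andP[cC /eqP ca] dD.
have dis : [disjoint C & A :\: C] by apply: disjoint_setD.
have oC x : x \in C -> porbit (c * d)%g x = C.
  move=> xC; rewrite (@eq_porbit_on C _ c) //.
  - by apply/eqP; rewrite -ca eq_porbit_mem ca.
  - by move=> y; apply: mul_permL dis cC dD.
  - by move=> y; rewrite (perm_closed _ cC).
have oD x : x \in A :\: C -> porbit (c * d)%g x = porbit d x.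
  move=> xD; rewrite (@eq_porbit_on (A :\: C) _ d) //.
  - by move=> y; apply: mul_permR dis cC dD.
  - by move=> y; rewrite (perm_closed _ dD).
have eA : porbit (c * d)%g @: A = C |: porbit d @: (A :\: C).
  apply/setP => O; rewrite in_setU1; apply/imsetP/orP.
    move=> [x xA ->]; case: (boolP (x \in C)) => xC.
      by left; rewrite oC.
    have xD : x \in A :\: C by rewrite inE xC.
    by right; rewrite oD // imset_f.
  case=> [/eqP ->|/imsetP[x xD ->]].
    by exists a; rewrite ?oC // (subsetP CA).
  by exists x; rewrite ?oD //; case/setDP: xD.
have CN : C \notin porbit d @: (A :\: C).
  apply/imsetP => -[x xD e]; case/setDP: (xD) => _ /negP; apply.
  by rewrite e porbit_id.
rewrite /cycle_type /insert_part; apply: sort_geq_eq.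
rewrite eA.
apply: (@perm_trans _ [seq #|pred_of_set C| | C <- C :: enum (porbit d @: (A :\: C))]).
  apply: perm_map; apply: uniq_perm.
  - exact: enum_uniq.
  - by rewrite /= mem_enum CN enum_uniq.
  by move=> O; rewrite inE !mem_enum in_setU1.
by rewrite /= perm_cons perm_sym perm_sort.
Qed.

(** Sort the permutations by the orbit [C] of [a]. Each preserves [C], so [sum_perm_split] cuts it
    into a full cycle on [C] and a permutation of the rest. *)
Lemma sum_perm_orbit (R : nmodType) A a (G : {perm T} -> R) : a \in A ->
  (\sum_(g | perm_on A g) G g
   = \sum_(C : {set T} | (a \in C) && (C \subset A))
       \sum_(c in cyclic_perms C a) \sum_(d | perm_on (A :\: C) d) G (c * d)%g)%R.
Proof.
move=> aA.
rewrite (partition_big (fun g => porbit g a)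
   (fun C : {set T} => (a \in C) && (C \subset A))) /=; last first.
  move=> g gA; rewrite porbit_id porbit_sub // => y.
  by rewrite (perm_closed _ gA).
apply: eq_bigr => C /andP[aC CA].
have dis : [disjoint C & A :\: C] by apply: disjoint_setD.
have eA : C :|: A :\: C = A.
  apply/setP => x; rewrite !inE; case: (boolP (x \in C)) => // xC.
  by rewrite (subsetP CA).
transitivity (\sum_(g | perm_on (C :|: A :\: C) g && (g @: C == C))
    (if porbit g a == C then G g else 0))%R.
  rewrite -big_mkcondr eA; apply: eq_bigl => g; rewrite -andbA; congr (_ && _).
  case: eqP => [<-|]; last by rewrite andbF.
  by rewrite imset_porbit eqxx.
rewrite sum_perm_split //.
under [RHS]eq_bigl => c do rewrite inE.
rewrite big_mkcondr; apply: eq_bigr => c cC.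
have oc d : perm_on (A :\: C) d -> porbit (c * d)%g a = porbit c a.
  move=> dD; apply: (@eq_porbit_on C) => //.
  - by move=> y; apply: mul_permL dis cC dD.
  - by move=> y; rewrite (perm_closed _ cC).
case: ifP => cC'; first by apply: eq_bigr => d dD; rewrite oc // cC'.
by apply: big1 => d dD; rewrite oc // cC'.
Qed.

Lemma sum_subsets (R : nmodType) (D : {set T}) (G : nat -> R) :
  (\sum_(B : {set T} | B \subset D) G #|B|
   = \sum_(k < #|D|.+1) G k *+ 'C(#|D|, k))%R.
Proof.
rewrite (partition_big (fun B : {set T} => inord #|B| : 'I_#|D|.+1) xpredT) //=.
apply: eq_bigr => k _; rewrite -cards_draws -sumr_const.
transitivity (\sum_(B in [set B : {set T} | (B \subset D) & (#|B| == k)]) G #|B|)%R.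
  apply: eq_bigl => B; rewrite inE; case: (boolP (B \subset D)) => //= BD.
  by rewrite -val_eqE /= inordK // ltnS subset_leq_card.
by apply: eq_bigr => B; rewrite inE => /andP[_ /eqP ->].
Qed.

Lemma sum_subsets_with (R : nmodType) A a (G : nat -> R) : a \in A ->
  (\sum_(C : {set T} | (a \in C) && (C \subset A)) G #|C|
   = \sum_(1 <= k < #|A|.+1) G k *+ 'C(#|A|.-1, k.-1))%R.
Proof.
move=> aA.
have cA : #|A| = #|A :\ a|.+1 by rewrite (cardsD1 a A) aA.
rewrite (reindex_onto (fun B => a |: B) (fun C => C :\ a)) /=; last first.
  by move=> C /andP[aC _]; rewrite setD1K.
transitivity (\sum_(B : {set T} | B \subset A :\ a) G #|B|.+1)%R.
  apply: eq_big => B.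
    rewrite setU11 /= subUset sub1set aA /= subsetD1; congr (_ && _).
    by apply/eqP/idP => [<-|/setU1K //]; rewrite !inE eqxx.
  move=> /andP[/andP[_ _] /eqP e]; have aB : a \notin B.
    by rewrite -e !inE eqxx.
  by rewrite cardsU1 aB.
rewrite (sum_subsets _ (fun k => G k.+1)) cA big_add1 big_mkord.
by apply: eq_bigr => k _.
Qed.

Lemma card_cyclic_perms C a : a \in C -> #|cyclic_perms C a| = #|C|.-1`!.
Proof.
move: {2}#|C| (leqnn #|C|) => N; elim: N C a => [|N IH] C a.
  by rewrite leqn0 cards_eq0 => /eqP ->; rewrite inE.
move=> CN aC.
pose W (D : {set T}) := (#|D|.-1`! * (#|C| - #|D|)`!)%N.
(* Each size [k] of [D] contributes C(c-1, k-1) (k-1)! (c-k)! = (c-1)! with [c = #|C|], and there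
   are [c] sizes. *)
have totW : (\sum_(D : {set T} | (a \in D) && (D \subset C)) W D)%N = #|C|`!.
  rewrite (sum_subsets_with (fun k => k.-1`! * (#|C| - k)`!)%N) //.
  have C0 : 0 < #|C| by rewrite card_gt0; apply/set0Pn; exists a.
  rewrite (eq_big_nat _ _ (F2 := fun _ => #|C|.-1`!)).
    rewrite sum_nat_const_nat subSS subn0 -{1 3}(prednK C0) factS.
    by [].
  move=> k /andP[k0 kC]; rewrite -mulr_natr /=.
  rewrite -(@bin_fact #|C|.-1 k.-1); last by lia.
  have -> : (#|C|.-1 - k.-1 = #|C| - k)%N by lia.
  by rewrite natn [RHS]mulnC.
have totP : (\sum_(D : {set T} | (a \in D) && (D \subset C))
     #|cyclic_perms D a| * (#|C| - #|D|)`!)%N = #|C|`!.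
  rewrite -card_perm -[RHS]sum1_card.
  have e : (\sum_(g | perm_on C g) 1 = _)%N := sum_perm_orbit (fun=> 1%N) aC.
  transitivity (\sum_(g | perm_on C g) 1)%N; last by apply: eq_bigl.
  rewrite e.
  apply: eq_bigr => D /andP[aD DC].
  rewrite -sum_nat_const; apply: eq_bigr => c _.
  rewrite sum1_card card_perm cardsD; congr (_ - _)`!.
  by move/setIidPr: DC => ->.
have aCC : (a \in C) && (C \subset C) by rewrite aC subxx.
move: totP; rewrite -totW (bigD1 C) //= [RHS](bigD1 C) //= /W subnn !muln1.
rewrite (eq_bigr W) => [/addIn //|D /andP[/andP[aD DC] nDC]].
rewrite IH // -ltnS; apply: leq_trans CN; apply: proper_card.
by rewrite properEneq nDC.
Qed.

Local Open Scope ring_scope.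

(** Fix a point of [A] and let [k] be the length of its orbit. There are C(r-1, k-1) such orbits and
    (k-1)! cycles on each, and the induction hypothesis adds the factor (r-k)!. The product is
    (r-1)! for every [k], and [partition_sum_rec] remains. *)
Lemma sum_perm_cycle_type A (F : seq nat -> rat) :
  \sum_(g | perm_on A g) F (cycle_type A g)
  = #|A|`!%:R * partition_sum #|A| F.
Proof.
move: {2}#|A| (leqnn #|A|) => N; elim: N A F => [|N IH] A F AN.
  have A0 : A = set0 by apply/eqP; rewrite -cards_eq0 -leqn0.
  rewrite A0 cards0 fact0 mul1r partition_sum0 (big_pred1 1%g) => [|g].
    by rewrite /cycle_type imset0 enum_set0.
  apply/idP/eqP => [g0|->]; last exact: perm_on1.
  by apply: (perm_on_id g0); rewrite cards0.
have [->|[a aA]] := set_0Vmem A; first by apply: IH; rewrite cards0.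
rewrite (sum_perm_orbit _ aA).
pose r := #|A|.
transitivity (\sum_(C : {set T} | (a \in C) && (C \subset A))
   (#|C|.-1`!)%:R * ((r - #|C|)`!%:R * partition_sum (r - #|C|) (F \o insert_part #|C|))).
  apply: eq_bigr => C /andP[aC CA].
  have cD : #|A :\: C| = (r - #|C|)%N by rewrite cardsD; move/setIidPr: CA => ->.
  rewrite -cD -IH; last first.
    have : (0 < #|C|)%N by rewrite card_gt0; apply/set0Pn; exists a.
    by rewrite cD /r; lia.
  rewrite -(card_cyclic_perms aC) mulr_natl -sumr_const; apply: eq_bigr => c cC.
  by apply: eq_bigr => d dD; rewrite /= (cycle_type_mul aC).
rewrite (sum_subsets_with (fun k => k.-1`!%:R * ((r - k)`!%:R *
   partition_sum (r - k) (F \o insert_part k))) aA).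
have r0 : (0 < r)%N by rewrite card_gt0; apply/set0Pn; exists a.
rewrite -/r -(prednK r0) factS (prednK r0) mulnC natrM -mulrA partition_sum_rec.
rewrite mulr_sumr; apply: eq_big_nat => k /andP[k0 kr].
rewrite mulrA -mulrnAl -natrM -mulr_natr -natrM -(@bin_fact r.-1 k.-1); last by lia.
have -> : (r.-1 - k.-1 = r - k)%N by lia.
by congr (_%:R * _); rewrite mulnC.
Qed.

End PermSums.

(** * Surjections and Stirling numbers *)

(** The number of surjections from [N] points to [c] points: one point has [c] possible values, and
    the others cover either everything or everything but this value. *)
Fixpoint surj (N c : nat) : nat :=
  match N, c with
  | 0, 0 => 1
  | 0, _.+1 => 0
  | _.+1, 0 => 0
  | N'.+1, c'.+1 => c * (surj N' c + surj N' c')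
  end.

Lemma surjSS N c : surj N.+1 c.+1 = c.+1 * (surj N c.+1 + surj N c).
Proof. by []. Qed.

Lemma surj_small N c : N < c -> surj N c = 0.
Proof.
elim: N c => [|N IH] [|c] // Nc.
by rewrite surjSS !IH //; lia.
Qed.

Lemma surj_diag b : surj b b = b`!.
Proof. by elim: b => // b IH; rewrite surjSS surj_small // IH factS. Qed.

(* Maps defined on [D] only are encoded as total maps with value [o] off [D]. *)
Definition onto_maps (I T : finType) (o : T) (D : {set I}) (R : {set T}) :
    {set {ffun I -> T}} :=
  [set v : {ffun I -> T} | [forall i, (i \notin D) ==> (v i == o)] && (v @: D == R)].

Lemma onto_mapsP (I T : finType) (o : T) (D : {set I}) (R : {set T})
    (v : {ffun I -> T}) :
  reflect ((forall i, i \notin D -> v i = o) /\ v @: D = R)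
          (v \in onto_maps o D R).
Proof.
rewrite inE; apply: (iffP andP) => -[h /eqP e]; split=> //.
- by move=> i iD; apply/eqP; move/forallP/(_ i)/implyP: h => ->.
- by apply/forallP => i; apply/implyP => /h ->.
Qed.

(** On [D] the map either takes the value [b] again or covers exactly the rest of [R]. *)
Lemma onto_maps_val (I T : finType) (o : T) (D : {set I}) (R : {set T})
    (i : I) (b : T) : i \notin D -> b \in R ->
  #|[set v in onto_maps o (i |: D) R | v i == b]|
  = #|onto_maps o D R| + #|onto_maps o D (R :\ b)|.
Proof.
move=> iD bR.
pose ext (v : {ffun I -> T}) := [ffun j => if j == i then b else v j].
have -> : [set v in onto_maps o (i |: D) R | v i == b] =
          ext @: (onto_maps o D R :|: onto_maps o D (R :\ b)).
  have im (v w : {ffun I -> T}) : (forall j, j != i -> v j = w j) -> v @: D = w @: D.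
    move=> vw; apply: eq_in_imset => j jD; apply: vw.
    by apply: contraNneq iD => <-.
  apply/setP => v; apply/setIdP/imsetP.
    move=> [/onto_mapsP[v0 vR] /eqP vi].
    exists [ffun j => if j == i then o else v j]; last first.
      by apply/ffunP => j; rewrite !ffunE; case: eqP => // ->.
    set w := finfun _.
    have w0 j : j \notin D -> w j = o.
      move=> jD; rewrite ffunE; case: eqP => // /eqP ji.
      by apply: v0; rewrite !inE negb_or ji.
    have wR : w @: D = v @: D by apply: im => j /negbTE ji; rewrite ffunE ji.
    move: vR; rewrite imsetU1 vi => vR; rewrite inE.
    case: (boolP (b \in v @: D)) => bD.
      apply/orP; left; apply/onto_mapsP; split=> //.
      by rewrite wR -vR; symmetry; apply/setUidPr; rewrite sub1set.
    apply/orP; right; apply/onto_mapsP; split=> //.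
    by rewrite wR -vR setU1K.
  move=> [w wU ->].
  have [w0 wR] : (forall j, j \notin D -> w j = o) /\ b |: w @: D = R.
    move: wU; rewrite inE => /orP[]/onto_mapsP[w0 wR]; split=> //.
      by rewrite wR; apply/setUidPr; rewrite sub1set.
    by rewrite wR setD1K.
  split; last by rewrite ffunE eqxx.
  apply/onto_mapsP; split=> [j|].
    by rewrite !inE negb_or ffunE => /andP[/negbTE -> /w0].
  rewrite imsetU1 ffunE eqxx -wR; congr (_ |: _); apply: im => j /negbTE ji.
  by rewrite ffunE ji.
rewrite card_in_imset => [|v w].
  rewrite cardsU disjoint_setI0 ?cards0 ?subn0 //.
  rewrite -setI_eq0; apply/eqP/setP => v; rewrite !inE; apply/negbTE/negP.
  move=> /andP[/andP[_ /eqP e1] /andP[_ /eqP e2]].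
  by move: bR; rewrite -e1 e2 !inE eqxx.
have U0 u : u \in onto_maps o D R :|: onto_maps o D (R :\ b) -> u i = o.
  by rewrite inE => /orP[]/onto_mapsP[u0 _]; apply: u0.
move=> /U0 v0 /U0 w0 e; apply/ffunP => j.
case: (eqVneq j i) => [->|/negbTE ji]; first by rewrite v0 w0.
by move/ffunP/(_ j): e; rewrite !ffunE ji.
Qed.

Lemma card_onto_maps_surj (I T : finType) (o : T) (D : {set I}) (R : {set T}) :
  #|onto_maps o D R| = surj #|D| #|R|.
Proof.
move DN: #|D| => N; elim: N D DN R => [|N IH] D /esym DN R.
  have -> : D = set0 by apply/eqP; rewrite -cards_eq0 -DN.
  case: (set_0Vmem R) => [->|[b bR]].
    rewrite cards0 /= -(cards1 [ffun _ : I => o]); apply: eq_card => v.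
    rewrite in_set1; apply/onto_mapsP/eqP => [[v0 _]|->].
      by apply/ffunP => i; rewrite ffunE v0 // inE.
    by rewrite imset0; split=> // i _; rewrite ffunE.
  rewrite (cardsD1 b R) bR /=; apply: eq_card0 => v; apply/negbTE/negP.
  by move=> /onto_mapsP[_ e]; move: bR; rewrite -e imset0 inE.
have /card_gt0P[i iD] : 0 < #|D| by rewrite -DN.
have DE : D = i |: (D :\ i) by rewrite setD1K.
have iN : i \notin D :\ i by rewrite !inE eqxx.
have DN' : N = #|D :\ i| by move: DN; rewrite (cardsD1 i D) iD => -[].
rewrite -sum1_card (partition_big (fun v : {ffun I -> T} => v i) (mem R)) /=; last first.
  by move=> v /onto_mapsP[_ <-]; apply: imset_f.
transitivity (\sum_(b in R) (surj N #|R| + surj N #|R|.-1)).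
  apply: eq_bigr => b bR.
  have -> : #|R|.-1 = #|R :\ b| by rewrite (cardsD1 b R) bR.
  rewrite -!(IH (D :\ i)) // -(onto_maps_val o iN bR) -sum1_card -DE.
  by apply: eq_bigl => v; rewrite inE.
rewrite sum_nat_const; case: #|R| => [|c] //.
Qed.

(** A surjection is the partition of its domain into fibres together with a bijection from the
    blocks to the values. *)
Lemma surj_stirling2 N b : surj N b = b`! * stirling2 N b.
Proof.
(* The extra point [ord0] serves as the default value off the domain; without it [R] has [b]
   points. *)
pose o : 'I_b.+1 := ord0; pose R := [set~ o].
have cR : #|R| = b by rewrite cardsC1 card_ord.
transitivity #|onto_maps o [set: 'I_N] R|.
  by rewrite card_onto_maps_surj cR cardsT card_ord.
rewrite -[LHS]sum1_card.
rewrite (partition_big (fun v : {ffun 'I_N -> 'I_b.+1} => preim_partition v [set: 'I_N])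
   (mem [set P : {set {set 'I_N}} | partition P [set: 'I_N] & #|P| == b])) /=.
  rewrite mulnC /stirling2 -sum_nat_const; apply: eq_bigr => P.
  rewrite inE => /andP[Ppart /eqP Pb].
  transitivity #|onto_maps o P R|; last by rewrite card_onto_maps_surj cR Pb surj_diag.
  pose ext (u : {ffun {set 'I_N} -> 'I_b.+1}) := [ffun i => u (pblock P i)].
  have [covP trivP P0] := and3P Ppart.
  have inC i : i \in cover P by rewrite (eqP covP) inE.
  have block B : B \in P -> exists2 i, i \in B & pblock P i = B.
    move=> BP; case: (set_0Vmem B) => [e|[i iB]].
      by move: P0; rewrite -e BP.
    by exists i => //; apply: def_pblock.
  have -> : #|onto_maps o P R| = #|ext @: onto_maps o P R|.
    rewrite card_in_imset // => u v /onto_mapsP[u0 _] /onto_mapsP[v0 _] e.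
    apply/ffunP => B; case: (boolP (B \in P)) => BP; last by rewrite u0 // v0.
    have [i _ <-] := block B BP; by move/ffunP/(_ i): e; rewrite !ffunE.
  rewrite sum1_card; apply: eq_card => v; rewrite [LHS]inE.
  apply/andP/imsetP.
    move=> [/onto_mapsP[_ vR] /eqP vP].
    have vb i j : (j \in pblock P i) = (v i == v j).
      by rewrite -vP pblock_equivalence_partition ?inE // => ? ? ? _ _ _;
         split=> // /eqP ->.
    pose u := [ffun B : {set 'I_N} => if B \in P then
                 (if [pick i in B] is Some i then v i else o) else o].
    have uv i : u (pblock P i) = v i.
      rewrite ffunE pblock_mem ?inC //; case: pickP => [j|/(_ i)].
        by rewrite vb => /eqP.
      by rewrite mem_pblock inC.
    exists u; last by apply/ffunP => i; rewrite ffunE uv.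
    apply/onto_mapsP; split=> [B BP|]; first by rewrite ffunE (negbTE BP).
    rewrite -vR; apply/setP => y; apply/imsetP/imsetP => -[].
      by move=> B BP ->; have [i _ <-] := block B BP; exists i.
    by move=> i _ ->; exists (pblock P i); rewrite ?pblock_mem.
  move=> [u /onto_mapsP[u0 uR] ->].
  (* [u] takes [b] values on [b] blocks, so distinct blocks stay distinct fibres. *)
  have uinj : {in P &, injective u} by apply/imset_injP; rewrite uR cR Pb.
  split.
    apply/onto_mapsP; split=> [i|]; first by rewrite inE.
    rewrite -uR; apply/setP => y; apply/imsetP/imsetP => -[].
      by move=> i _ ->; exists (pblock P i); rewrite ?pblock_mem ?ffunE.
    by move=> B BP ->; have [i _ <-] := block B BP; exists i; rewrite ?ffunE.
  apply/eqP; rewrite -[RHS](equivalence_partition_pblock Ppart).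
  apply: eq_imset => i; apply/setP => j; rewrite !inE /= !ffunE.
  apply/eqP/idP => [/uinj e|].
    by rewrite -eq_pblock // e // pblock_mem.
  by move=> /(same_pblock trivP) ->.
move=> v /onto_mapsP[_ vR]; rewrite inE preim_partitionP /=.
suff -> : #|preim_partition v [set: 'I_N]| = #|v @: [set: 'I_N]| by rewrite vR cR.
pose f (y : 'I_b.+1) := [set i | v i == y].
have -> : preim_partition v [set: 'I_N] = f @: (v @: [set: 'I_N]).
  rewrite -imset_comp; apply: eq_imset => i; apply/setP => j.
  by rewrite !inE /= eq_sym.
rewrite card_in_imset // => y z /imsetP[i _ ->] _ e.
by move/setP/(_ i): e; rewrite !inE eqxx => /esym/eqP.
Qed.

(** The value [o] is optional, so with [N = #|D|] and [c = #|R|] the count is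
    [surj N c.+1 + surj N c]. The recursion for [surj N.+1 c.+1] turns this into one Stirling number
    with both arguments raised by 1. *)
Lemma card_pointed_onto_maps (I T : finType) (o : T) (D : {set I}) (R : {set T}) :
  o \notin R ->
  #|[set v : {ffun I -> T} | [forall i, (i \notin D) ==> (v i == o)]
                            && (o |: v @: D == o |: R)]|
  = #|R|`! * stirling2 #|D|.+1 #|R|.+1.
Proof.
move=> oR.
have -> : [set v : {ffun I -> T} | [forall i, (i \notin D) ==> (v i == o)]
                            && (o |: v @: D == o |: R)]
        = onto_maps o D (o |: R) :|: onto_maps o D ((o |: R) :\ o).
  apply/setP => v; rewrite !inE -andb_orr; congr (_ && _).
  apply/eqP/orP => [e|[]/eqP ->]; last 2 first.
  - by rewrite setUA setUid.
  - by rewrite setD1K // setU11.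
  case: (boolP (o \in v @: D)) => oD; [left | right]; apply/eqP; rewrite -e.
    by symmetry; apply/setUidPr; rewrite sub1set.
  by rewrite setU1K.
rewrite cardsU disjoint_setI0; last first.
  rewrite -setI_eq0; apply/eqP/setP => v; rewrite !inE; apply/negbTE/negP.
  move=> /andP[/andP[_ /eqP e1] /andP[_ /eqP e2]].
  by move: (setU11 o R); rewrite -e1 e2 !inE eqxx.
rewrite cards0 subn0 !card_onto_maps_surj setU1K // cardsU1 oR add1n.
apply/eqP; rewrite -(eqn_pmul2l (ltn0Sn #|R|)) -surjSS surj_stirling2 factS.
by rewrite mulnA.
Qed.

(** * Maps intertwining a permutation with an involution *)

Lemma porbit_dvd (T : finType) (s : {perm T}) x i :
  ((s ^+ i)%g x == x) = (#|porbit s x| %| i).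
Proof.
set d := #|porbit s x|.
have d0 : 0 < d by rewrite lt0n card_porbit_neq0.
have sd1 : (s ^+ d)%g x = x by rewrite permX iter_porbit.
have sd j : (s ^+ (j * d))%g x = x.
  elim: j => [|j IH]; first by rewrite perm1.
  by rewrite mulSn expgD permM sd1.
rewrite /dvdn {1}(divn_eq i d) expgD permM sd permX.
have id : i %% d < d by rewrite ltn_mod.
have := nth_uniq x (s := traject s x d) (i := i %% d) (j := 0).
rewrite size_traject !nth_traject //= => -> //.
exact: uniq_traject_porbit.
Qed.

Definition steps (T : finType) (s : {perm T}) (r x : T) :=
  index x (traject s r #|porbit s r|).

Lemma stepsP (T : finType) (s : {perm T}) r x :
  x \in porbit s r -> (s ^+ steps s r x)%g r = x.
Proof.
rewrite porbit_traject permX => xr; rewrite /steps.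
rewrite -(nth_traject s (_ : _ < #|porbit s r|)) ?nth_index //.
by rewrite -[X in _ < X](size_traject s r) index_mem.
Qed.

Lemma involution_exp (T : finType) (h : {perm T}) i b : involutive h ->
  (h ^+ i)%g b = if odd i then h b else b.
Proof.
move=> hK; elim: i => [|i IH]; first by rewrite perm1.
by rewrite expgSr permM IH /=; case: (odd i) => /=.
Qed.

Section OrbitValues.
Variables (U T : finType) (o : T) (X : {set U}) (p : {perm U}).
Variables (R : {set T}) (h : {perm T}).
Hypothesis pX : forall x, x \in X -> p x \in X.
Hypothesis hK : involutive h.
Hypothesis oR : o \notin R.
Hypothesis hR : perm_on R h.

(** Used with [X] the pairs over [A], [p] the twisted action on them and [o] the zero, which need
    not be a product of elements of [A]. *)
Definition intertwiners : {set {ffun U -> T}} :=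
  [set f : {ffun U -> T} | [&& [forall x, (x \notin X) ==> (f x == o)],
     [forall x in X, f (p x) == h (f x)] & o |: f @: X == o |: R]].

(* Values on orbits: an orbit of odd length must go to a fixed point of [h]. *)
Definition orbit_values (I : finType) (Qe Qo : {set I}) : {set {ffun I -> T}} :=
  [set v : {ffun I -> T} | [&& [forall C, (C \notin Qe :|: Qo) ==> (v C == o)],
     [forall C in Qo, h (v C) == v C],
     [forall C in Qe :|: Qo, v C \in o |: R] &
     [forall b in R, exists C in Qe :|: Qo, (v C == b) || (h (v C) == b)]]].

Lemma orbit_valuesP (I : finType) (Qe Qo : {set I}) (v : {ffun I -> T}) :
  reflect [/\ forall C, C \notin Qe :|: Qo -> v C = o,
              forall C, C \in Qo -> h (v C) = v C,
              forall C, C \in Qe :|: Qo -> v C \in o |: R &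
              forall b, b \in R ->
                exists2 C, C \in Qe :|: Qo & v C = b \/ h (v C) = b]
          (v \in orbit_values Qe Qo).
Proof.
rewrite inE; apply: (iffP and4P) => -[h1 h2 h3 h4]; split.
- by move=> C CQ; move/forallP/(_ C): h1; rewrite CQ => /eqP.
- by move=> C CQ; move/forall_inP/(_ C CQ): h2 => /eqP.
- by move=> C CQ; move/forall_inP/(_ C CQ): h3.
- move=> b bR; move/forall_inP/(_ b bR): h4 => /exists_inP[C CQ].
  by move=> /orP[]/eqP e; exists C => //; [left|right].
- by apply/forallP => C; apply/implyP => /h1 ->.
- by apply/forall_inP => C /h2 ->.
- by apply/forall_inP => C /h3.
apply/forall_inP => b /h4 [C CQ e]; apply/exists_inP; exists C => //.
by case: e => ->; rewrite eqxx ?orbT.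
Qed.

Lemma intertwinersP (f : {ffun U -> T}) :
  reflect [/\ forall x, x \notin X -> f x = o,
              forall x, x \in X -> f (p x) = h (f x) & o |: f @: X = o |: R]
          (f \in intertwiners).
Proof.
rewrite inE; apply: (iffP and3P) => -[h1 h2 h3]; split.
- by move=> x xX; move/forallP/(_ x): h1; rewrite xX => /eqP.
- by move=> x xX; move/forall_inP/(_ x xX): h2 => /eqP.
- exact/eqP.
- by apply/forallP => x; apply/implyP => /h1 ->.
- by apply/forall_inP => x /h2 ->.
- exact/eqP.
Qed.

Definition even_orbits := [set C in porbit p @: X | ~~ odd #|C|].
Definition odd_orbits := [set C in porbit p @: X | odd #|C|].

Lemma even_odd_orbits : even_orbits :|: odd_orbits = porbit p @: X.
Proof. by apply/setP => C; rewrite !inE -andb_orr orNb andbT. Qed.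

Lemma iter_in i x : x \in X -> (p ^+ i)%g x \in X.
Proof.
by move=> xX; elim: i => [|i IH]; rewrite ?perm1 // expgSr permM pX.
Qed.

Lemma intertwiner_iter (f : {ffun U -> T}) i x : f \in intertwiners -> x \in X ->
  f ((p ^+ i)%g x) = (h ^+ i)%g (f x).
Proof.
move=> /intertwinersP[_ fp _] xX; elim: i => [|i IH]; first by rewrite !perm1.
by rewrite !expgSr !permM fp ?iter_in // IH.
Qed.

Definition rep_value (f : {ffun U -> T}) : {ffun {set U} -> T} :=
  [ffun C => if C \in porbit p @: X then
               (if [pick r in C] is Some r then f r else o) else o].

Lemma pick_orbit C : C \in porbit p @: X ->
  exists r, [/\ [pick r in C] = Some r, r \in X & C = porbit p r].
Proof.
move=> /imsetP[x xX ->]; case: pickP => [r rx|/(_ x)]; last by rewrite porbit_id.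
exists r; split=> //; last by apply/eqP; rewrite eq_porbit_mem porbit_sym.
by apply: (subsetP (porbit_sub pX xX)).
Qed.

(** By [intertwiner_iter] the value at one point of an orbit determines all others. *)
Lemma rep_value_inj : {in intertwiners &, injective rep_value}.
Proof.
move=> f1 f2 f1P f2P e; apply/ffunP => x.
case: (boolP (x \in X)) => xX; last first.
  by case/intertwinersP: f1P => -> // _ _; case/intertwinersP: f2P => ->.
have CQ := imset_f (porbit p) xX.
have [r [pr rX Cr]] := pick_orbit CQ.
have fr : f1 r = f2 r by move/ffunP/(_ (porbit p x)): e; rewrite !ffunE CQ pr.
have xr : x \in porbit p r by rewrite -Cr porbit_id.
by rewrite -(stepsP xr) !intertwiner_iter // fr.
Qed.

(** Going once round an odd orbit applies the involution [h] an odd number of times, so the value is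
    fixed by [h]. A point of [R] taken anywhere on an orbit is the value at the representative or
    its image under [h]. *)
Lemma rep_value_in f : f \in intertwiners ->
  rep_value f \in orbit_values even_orbits odd_orbits.
Proof.
move=> fP; have [_ fp fR] := intertwinersP _ fP.
apply/orbit_valuesP; rewrite even_odd_orbits; split.
- by move=> C CQ; rewrite ffunE (negbTE CQ).
- move=> C; rewrite inE => /andP[CQ Codd].
  have [r [pr rX Cr]] := pick_orbit CQ; rewrite ffunE CQ pr.
  have := intertwiner_iter #|porbit p r| fP rX.
  by rewrite permX iter_porbit involution_exp // -Cr Codd.
- move=> C CQ; have [r [pr rX Cr]] := pick_orbit CQ.
  by rewrite ffunE CQ pr -fR !inE imset_f ?orbT.
move=> b bR; have : b \in o |: f @: X by rewrite fR !inE bR orbT.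
rewrite in_setU1 (negbTE (_ : b != o)) /=; last by apply: contraNneq oR => <-.
move=> /imsetP[x xX ->]; exists (porbit p x); first by rewrite imset_f.
have CQ := imset_f (porbit p) xX.
have [r [pr rX Cr]] := pick_orbit CQ.
have xr : x \in porbit p r by rewrite -Cr porbit_id.
rewrite ffunE CQ pr -(stepsP xr) intertwiner_iter // involution_exp //.
by case: (odd _); [right|left].
Qed.

(** The inverse of [rep_value]: the value of an orbit is put at its representative and carried along
    by [h]. *)
Definition spread (v : {ffun {set U} -> T}) : {ffun U -> T} :=
  [ffun x => if x \in X then
     (if [pick r in porbit p x] is Some r
      then (h ^+ steps p r x)%g (v (porbit p x)) else o) else o].

(** Exponents leading to the same point differ by a multiple of the orbit length. On an even orbit
    they have equal parity, and on an odd orbit the value is fixed by [h]; in both cases the powers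
    of [h] agree. *)
Lemma spreadE v r i : v \in orbit_values even_orbits odd_orbits ->
  r \in X -> [pick z in porbit p r] = Some r ->
  spread v ((p ^+ i)%g r) = (h ^+ i)%g (v (porbit p r)).
Proof.
move=> /orbit_valuesP[_ vo _ _] rX pr.
rewrite ffunE iter_in // porbit_perm pr !(involution_exp _ _ hK).
set j := steps _ _ _.
have e : (p ^+ j)%g r = (p ^+ i)%g r by rewrite [LHS]stepsP ?mem_porbit.
case: (boolP (odd #|porbit p r|)) => C2.
  have hv : h (v (porbit p r)) = v (porbit p r) by apply: vo; rewrite inE imset_f.
  by case: (odd i); case: (odd j).
suff -> : odd i = odd j by [].
wlog ij : i j e / i <= j.
  move=> W; case: (leqP i j) => [|/ltnW]; first exact: W.
  by move=> ji; rewrite (W j i).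
have : (p ^+ (j - i))%g r == r.
  by apply/eqP/(@perm_inj _ (p ^+ i)%g); rewrite -permM -expgD subnK.
rewrite porbit_dvd => /dvdnP[k ek].
by rewrite -(subnK ij) oddD ek oddM (negbTE C2) andbF.
Qed.

Lemma card_intertwiners_values :
  #|intertwiners| = #|orbit_values even_orbits odd_orbits|.
Proof.
rewrite -(card_in_imset rep_value_inj); apply: eq_card => v.
apply/imsetP/idP => [[f fP ->]|vP]; first exact: rep_value_in.
have [v0 vo vR vs] := orbit_valuesP _ _ _ vP.
rewrite even_odd_orbits in v0 vR vs.
have vrep C : C \in porbit p @: X -> exists r,
   [/\ [pick z in porbit p r] = Some r, r \in X & C = porbit p r].
  by move=> CQ; have [r [pr rX Cr]] := pick_orbit CQ; exists r; rewrite -{1}Cr.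
have sv C : C \in porbit p @: X -> forall x, x \in C ->
    spread v x = v C \/ spread v x = h (v C).
  move=> CQ x xC; have [r [pr rX Cr]] := vrep C CQ.
  rewrite Cr in xC *; rewrite -(stepsP xC) spreadE // involution_exp //.
  by case: odd; [right|left].
have hoR b : b \in o |: R -> h b \in o |: R.
  rewrite !in_setU1 => /orP[/eqP ->|bR]; last by rewrite (perm_closed _ hR) bR orbT.
  by rewrite (out_perm hR) // eqxx.
exists (spread v); last first.
  apply/ffunP => C; rewrite ffunE; case: ifP => [CQ|/negbT /v0 //].
  have [r [pr rX Cr]] := vrep C CQ; rewrite Cr pr.
  by have := spreadE 0 vP rX pr; rewrite !perm1.
apply/intertwinersP; split.
- by move=> x xX; rewrite ffunE (negbTE xX).
- move=> x xX; have [r [pr rX Cr]] := vrep _ (imset_f (porbit p) xX).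
  have xr : x \in porbit p r by rewrite -Cr porbit_id.
  rewrite -(stepsP xr) -permM -expgSr !spreadE //.
  by rewrite expgSr permM.
apply/eqP; rewrite eqEsubset; apply/andP; split; apply/subsetP => b.
  rewrite in_setU1 => /orP[/eqP ->|/imsetP[x xX ->]]; first exact: setU11.
  have CQ := imset_f (porbit p) xX.
  by have [->|->] := sv _ CQ x (porbit_id p x); rewrite ?hoR ?vR.
rewrite in_setU1 => /orP[/eqP ->|/vs[C CQ e]]; first exact: setU11.
have [r [pr rX Cr]] := vrep _ CQ; rewrite in_setU1; apply/orP; right.
(* The exponents 0 and 1 lead to points with the values [v C] and [h (v C)]. *)
case: e => <-; apply/imsetP; [exists ((p ^+ 0)%g r)|exists ((p ^+ 1)%g r)].
- by rewrite iter_in.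
- by rewrite spreadE // perm1 Cr.
- by rewrite iter_in.
by rewrite spreadE // expg1 Cr.
Qed.

End OrbitValues.

(** * Counting orbit values by the 2-cycles of the involution *)

Section ValuesCount.
Variables (I T : finType) (o : T) (R : {set T}) (h : {perm T}).
Hypothesis hK : involutive h.

Definition moved : {set T} := [set b | h b != b].

(* One point from each 2-cycle of [h]. *)
Definition half_moved : {set T} := [set b | enum_rank b < enum_rank (h b)].

Lemma half_movedP b : b \in half_moved -> b \in moved.
Proof. by rewrite !inE => bh; apply: contraTneq bh => ->; rewrite ltnn. Qed.

Lemma moved_perm b : (h b \in moved) = (b \in moved).
Proof. by rewrite !inE hK eq_sym. Qed.

Lemma half_moved_perm b : b \in moved -> (h b \in half_moved) = (b \notin half_moved).
Proof.
rewrite !inE hK => bm; case: (ltngtP (enum_rank b) (enum_rank (h b))) => //.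
by move=> /ord_inj/enum_rank_inj e; move: bm; rewrite -e eqxx.
Qed.

Lemma card_moved : #|moved| = 2 * #|half_moved|.
Proof.
have -> : moved = half_moved :|: h @: half_moved.
  apply/setP => b; rewrite [RHS]inE; apply/idP/orP => [bm|].
    case: (boolP (b \in half_moved)) => bh; [by left|right].
    apply/imsetP; exists (h b); last by rewrite hK.
    by rewrite half_moved_perm.
  case=> [/half_movedP //|/imsetP[c /half_movedP cm ->]].
  by rewrite moved_perm.
rewrite cardsU disjoint_setI0 ?cards0 ?subn0.
  by rewrite card_imset; [lia|exact: perm_inj].
rewrite -setI_eq0; apply/eqP/setP => b; rewrite in_setI in_set0.
apply/negbTE/negP => /andP[bh /imsetP[c ch e]].
by move: bh; rewrite e half_moved_perm ?ch // half_movedP.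
Qed.

Definition moved_values (J : {set I}) : {set {ffun I -> T}} :=
  [set v : {ffun I -> T} | [&& [forall C, (C \notin J) ==> (v C == o)],
     [forall C in J, v C \in moved] &
     [forall b in moved, exists C in J, (v C == b) || (h (v C) == b)]]].

Lemma moved_valuesP (J : {set I}) (v : {ffun I -> T}) :
  reflect [/\ forall C, C \notin J -> v C = o,
              forall C, C \in J -> v C \in moved &
              forall b, b \in moved ->
                exists2 C, C \in J & v C = b \/ h (v C) = b]
          (v \in moved_values J).
Proof.
rewrite inE; apply: (iffP and3P) => -[h1 h3 h4]; split.
- by move=> C CQ; move/forallP/(_ C): h1; rewrite CQ => /eqP.
- by move=> C CQ; move/forall_inP/(_ C CQ): h3.
- move=> b bR; move/forall_inP/(_ b bR): h4 => /exists_inP[C CQ].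
  by move=> /orP[]/eqP e; exists C => //; [left|right].
- by apply/forallP => C; apply/implyP => /h1 ->.
- by apply/forall_inP => C /h3.
apply/forall_inP => b /h4 [C CQ e]; apply/exists_inP; exists C => //.
by case: e => ->; rewrite eqxx ?orbT.
Qed.

(** Choose the 2-cycle of each element of [J], as a surjection onto the representatives
    [half_moved], and independently the subset [K] of [J] on which the other point of the 2-cycle is
    taken. *)
Lemma card_moved_values J :
  #|moved_values J| = 2 ^ #|J| * surj #|J| #|half_moved|.
Proof.
rewrite -card_powerset -(card_onto_maps_surj o) -cardsX.
pose tw (Kw : {set I} * {ffun I -> T}) : {ffun I -> T} :=
  [ffun C => if C \in Kw.1 then h (Kw.2 C) else Kw.2 C].
have onto_half w C : w \in onto_maps o J half_moved -> C \in J -> w C \in half_moved.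
  by move=> /onto_mapsP[_ <-] CJ; apply: imset_f.
rewrite -[RHS](@card_in_imset _ _ tw); last first.
  move=> [K1 w1] [K2 w2] /setXP[/= K1J w1J] /setXP[/= K2J w2J] /ffunP e.
  have eC C : (C \in K1) = (C \in K2) /\ w1 C = w2 C.
    rewrite !inE in K1J K2J.
    have := e C; rewrite !ffunE /=; case: (boolP (C \in J)) => CJ.
      have h1 := onto_half _ _ w1J CJ; have h2 := onto_half _ _ w2J CJ.
      case: ifP; case: ifP => // _ _; first by move=> /perm_inj.
      - move=> e'; move: h2; rewrite -e' half_moved_perm ?h1 //.
        exact: half_movedP.
      - move=> e'; move: h1; rewrite e' half_moved_perm ?h2 //.
        exact: half_movedP.
    rewrite !(contraNF (subsetP K1J C)) // !(contraNF (subsetP K2J C)) //.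
  congr (_, _); first by apply/setP => C; case: (eC C).
  by apply/ffunP => C; case: (eC C).
apply: eq_card => v; apply/moved_valuesP/imsetP => [[v0 vm vs]|].
  pose K := [set C in J | v C \notin half_moved].
  have KE C : (C \in K) = (C \in J) && (v C \notin half_moved) by rewrite inE.
  pose w := [ffun C => if C \in K then h (v C) else v C].
  exists (K, w); last first.
    by apply/ffunP => C; rewrite !ffunE /=; case: (C \in K); rewrite ?hK.
  have wJ C : C \in J -> w C \in half_moved.
    move=> CJ; rewrite ffunE KE CJ /=; case: ifP => [CH|/negbFE //].
    by rewrite half_moved_perm // vm.
  apply/setXP; split; first by rewrite inE; apply/subsetP => C; rewrite inE => /andP[].
  apply/onto_mapsP; split => [C CJ|]; first by rewrite ffunE KE (negbTE CJ) v0.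
  apply/eqP; rewrite eqEsubset; apply/andP; split; apply/subsetP => b.
    by move=> /imsetP[C CJ ->]; apply: wJ.
  move=> bh; have [C CJ e] := vs b (half_movedP bh).
  apply/imsetP; exists C => //; rewrite ffunE KE CJ /=.
  case: e => e; first by rewrite e bh.
  by rewrite -half_moved_perm ?vm // e bh.
move=> [[K w] /setXP[/= KJ wJ] ->]; rewrite inE in KJ.
have [w0 wR] := onto_mapsP _ _ _ _ wJ; split.
- by move=> C CJ; rewrite ffunE (contraNF (subsetP KJ C)) //= w0.
- move=> C CJ; rewrite ffunE /=; have := half_movedP (onto_half _ _ wJ CJ).
  by case: ifP; rewrite ?moved_perm.
move=> b bm; case: (boolP (b \in half_moved)) => bh.
  move: bh; rewrite -wR => /imsetP[C CJ ->]; exists C => //; rewrite ffunE /=.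
  by case: ifP; [right; rewrite hK|left].
move: bh; rewrite -half_moved_perm // -wR => /imsetP[C CJ e]; exists C => //.
rewrite ffunE /= -e hK.
by case: ifP; [left|right; rewrite hK].
Qed.

Hypothesis oR : o \notin R.
Hypothesis hR : perm_on R h.

Lemma moved_sub : moved \subset R.
Proof.
apply/subsetP => b; rewrite inE; apply: contraR => bR.
by rewrite (out_perm hR bR).
Qed.

Variables Qe Qo : {set I}.
Hypothesis QQ : [disjoint Qe & Qo].

Let fixed_values (D : {set I}) :=
  [set v : {ffun I -> T} | [forall C, (C \notin D) ==> (v C == o)]
                         && (o |: v @: D == o |: (R :\: moved))].

(** Moved points of [R] can be covered only from [J], and points fixed by [h] only from outside [J].
    So [v] is an arbitrary combination of a map of the first kind on [J] and one of the second kind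
    on the other orbits. *)
Lemma card_orbit_values_moved (J : {set I}) : J \subset Qe ->
  #|[set v in orbit_values o R h Qe Qo |
       [set C in Qe :|: Qo | v C \in moved] == J]|
  = #|moved_values J| * #|fixed_values ((Qe :|: Qo) :\: J)|.
Proof.
move=> JQe; rewrite -cardsX.
set Q := Qe :|: Qo.
have JQ C : C \in J -> C \in Q by move=> /(subsetP JQe) CQe; rewrite inE CQe.
pose glue (vw : {ffun I -> T} * {ffun I -> T}) : {ffun I -> T} :=
  [ffun C => if C \in J then vw.1 C else vw.2 C].
have fixedP w : w \in fixed_values (Q :\: J) ->
    [/\ forall C, C \notin Q :\: J -> w C = o,
        forall C, C \in Q -> C \notin J -> w C \in o |: (R :\: moved) &
        forall b, b \in R :\: moved -> exists2 C, C \in Q :\: J & w C = b].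
  rewrite inE => /andP[/forallP w0 /eqP wR]; split.
  - by move=> C CD; move/implyP/(_ CD): (w0 C) => /eqP.
  - move=> C CQ CJ; rewrite -wR in_setU1 imset_f ?orbT //.
    by rewrite inE CJ.
  move=> b bR; have : b \in o |: w @: (Q :\: J) by rewrite wR in_setU1 bR orbT.
  rewrite in_setU1 => /orP[/eqP bo|/imsetP[C CD ->]]; last by exists C.
  by move: bR; rewrite bo inE (negbTE oR) andbF.
have ofix : o \notin moved by apply: contra oR => /(subsetP moved_sub).
have fixN c : c \in o |: (R :\: moved) -> c \notin moved.
  by rewrite in_setU1 => /orP[/eqP ->|/setDP[]].
rewrite -[RHS](@card_in_imset _ _ glue); last first.
  move=> [v1 w1] [v2 w2] /setXP[/= v1P /fixedP[w10 _ _]].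
  move=> /setXP[/= v2P /fixedP[w20 _ _]] /ffunP e.
  have [v10 _ _] := moved_valuesP _ _ v1P; have [v20 _ _] := moved_valuesP _ _ v2P.
  congr (_, _); apply/ffunP => C; have := e C; rewrite !ffunE /=.
    by case: (boolP (C \in J)) => CJ //; rewrite v10 // v20.
  case: (boolP (C \in J)) => CJ // _.
  by rewrite w10 ?w20 // inE CJ.
apply: eq_card => v; rewrite [LHS]inE; apply/andP/imsetP.
  move=> [/orbit_valuesP[v0 vo vR vs] /eqP vJ].
  have inJ C : C \in Q -> (C \in J) = (v C \in moved).
    by move=> CQ; rewrite -vJ inE CQ.
  exists ([ffun C => if C \in J then v C else o],
          [ffun C => if C \in J then o else v C]); last first.
    by apply/ffunP => C; rewrite !ffunE /=; case: (C \in J).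
  apply/setXP; split=> /=.
    apply/moved_valuesP; split.
    - by move=> C /negbTE CJ; rewrite ffunE CJ.
    - by move=> C CJ; rewrite ffunE CJ -inJ // JQ.
    move=> b bm; have [C CQ e] := vs b (subsetP moved_sub _ bm).
    have CJ : C \in J by rewrite inJ //; case: e bm => <- //; rewrite moved_perm.
    by exists C => //; rewrite ffunE CJ.
  rewrite inE; apply/andP; split.
    apply/forallP => C; apply/implyP; rewrite in_setD negb_and negbK ffunE.
    by case: (C \in J) => /= [_ | /v0 ->]; rewrite eqxx.
  rewrite eqEsubset; apply/andP; split; apply/subsetP => b.
    rewrite in_setU1 => /orP[/eqP ->|/imsetP[C /setDP[CQ CJ] ->]].
      exact: setU11.
    have := vR C CQ; rewrite ffunE (negbTE CJ) !in_setU1 => /orP[-> //|vCR].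
    by rewrite inE vCR andbT -inJ // CJ orbT.
  rewrite in_setU1 => /orP[/eqP ->|/setDP[bR bm]]; first exact: setU11.
  have [C CQ e] := vs b bR.
  have hb : h b = b by apply/eqP; move: bm; rewrite inE negbK.
  (* If [h (v C) = b] with [b] fixed, then [v C = h b = b] as well. *)
  have eb : v C = b by case: e => // /(congr1 h); rewrite hK hb.
  rewrite in_setU1; apply/orP; right; apply/imsetP.
  have CJ : C \notin J by rewrite inJ // eb.
  by exists C; [rewrite in_setD CJ|rewrite ffunE (negbTE CJ) eb].
move=> [[v1 w1] /setXP[/= v1P /fixedP[w10 w1f w1s]] ->].
have [v10 v1m v1s] := moved_valuesP _ _ v1P.
have Jo C : C \in Qo -> C \notin J.
  by move=> Co; apply: contraL Co => /(subsetP JQe) Ce; rewrite (disjointFr QQ).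
have gm C : C \in Q -> (glue (v1, w1) C \in moved) = (C \in J).
  move=> CQ; rewrite ffunE /=; case: (boolP (C \in J)) => CJ; first by rewrite v1m.
  by apply/negbTE/fixN/w1f.
split; last first.
  apply/eqP/setP => C; rewrite inE; case: (boolP (C \in Q)) => CQ; first by rewrite gm.
  by symmetry; apply: contraNF CQ; apply: JQ.
apply/orbit_valuesP; split.
- move=> C CQ; have CJ : C \notin J by apply: contra CQ; apply: JQ.
  by rewrite ffunE (negbTE CJ) /= w10 // inE (negbTE CQ) andbF.
- move=> C Co; have CQ : C \in Q by rewrite inE Co orbT.
  by apply/eqP; have := gm C CQ; rewrite inE (negbTE (Jo C Co)) => /negbFE.
- move=> C CQ; rewrite ffunE /=; case: (boolP (C \in J)) => CJ.
    by rewrite in_setU1 (subsetP moved_sub) ?v1m ?orbT.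
  have := w1f C CQ CJ; rewrite !in_setU1 => /orP[-> //|/setDP[-> _]].
  by rewrite orbT.
move=> b bR; case: (boolP (b \in moved)) => bm.
  by have [C CJ e] := v1s b bm; exists C; rewrite ?JQ // ffunE CJ.
have [|C /setDP[CQ CJ] e] := w1s b; first by rewrite inE bm.
by exists C => //; left; rewrite ffunE (negbTE CJ).
Qed.

(** Sum over the set [J] of orbits with moved values; it lies in [Qe] since values on [Qo] are fixed
    by [h]. The orbits outside [J] cover the [#|R| - 2 * #|half_moved|] fixed points of [R], with
    [o] optional. *)
Lemma card_orbit_values :
  #|orbit_values o R h Qe Qo|
  = \sum_(j < #|Qe|.+1) 'C(#|Qe|, j) *
      (2 ^ j * surj j #|half_moved| *
       ((#|R| - 2 * #|half_moved|)`! *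
        stirling2 (#|Qe| + #|Qo| - j).+1 (#|R| - 2 * #|half_moved|).+1)).
Proof.
have cR : #|R :\: moved| = #|R| - 2 * #|half_moved|.
  by rewrite cardsD -card_moved; have /setIidPr -> := moved_sub.
pose N j := 2 ^ j * surj j #|half_moved| *
       ((#|R| - 2 * #|half_moved|)`! *
        stirling2 (#|Qe| + #|Qo| - j).+1 (#|R| - 2 * #|half_moved|).+1).
transitivity (\sum_(J : {set I} | J \subset Qe) N #|J|).
  rewrite -sum1_card (partition_big (fun v : {ffun I -> T} => [set C in Qe :|: Qo | v C \in moved])
    (fun J : {set I} => J \subset Qe)) /=; last first.
    move=> v /orbit_valuesP[_ vo _ _]; apply/subsetP => C; rewrite !inE.
    by case/andP => /orP[//|/vo ->]; rewrite eqxx.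
  apply: eq_bigr => J JQe; rewrite /N -card_moved_values.
  have -> : (#|Qe| + #|Qo| - #|J|) = #|(Qe :|: Qo) :\: J|.
    rewrite cardsD cardsU (disjoint_setI0 QQ) cards0 subn0.
    have /setIidPr -> // : J \subset Qe :|: Qo.
    by apply: subset_trans JQe _; apply: subsetUl.
  rewrite -cR -(@card_pointed_onto_maps I T o); last by rewrite inE (negbTE oR) andbF.
  rewrite -card_orbit_values_moved // sum1_card; apply: eq_card => v.
  by rewrite [RHS]inE.
rewrite (sum_subsets Qe N); apply: eq_bigr => j _.
by rewrite -mulr_natl natn.
Qed.

End ValuesCount.

(** * Sums over involutions by the number of 2-cycles *)

Section InvolutionSums.
Local Open Scope ring_scope.

(** Being an involution and having a given number of 2-cycles depend only on the cycle type, which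
    makes [sum_perm_cycle_type] applicable. *)
Definition involution_weight (Y : nat -> rat) (l : seq nat) : rat :=
  if all (geq 2) l then Y (count_mem 2 l) else 0.

Lemma involution_weight_insert Y k l :
  involution_weight Y (insert_part k l) =
  if (k <= 2)%N then involution_weight (fun t => Y ((k == 2) + t)%N) l else 0.
Proof.
rewrite /involution_weight (perm_all _ (perm_insert k l)) /=.
rewrite (seq.permP (perm_insert k l)) /=.
by case: (k <= 2)%N.
Qed.

(** The factor of [Y t] is the number of involutions of [r] points with [t] 2-cycles, divided by
    [r!]. *)
Definition involution_term (r : nat) (Y : nat -> rat) (t : nat) : rat :=
  if (2 * t <= r)%N then Y t / (2 ^ t * t`! * (r - 2 * t)`!)%:R else 0.

(** Induction by [partition_sum_rec], in which only the parts 1 and 2 contribute. The bound [N] is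
    kept free because removing a part 2 lowers it by 1. *)
Lemma partition_sum_involution (r N : nat) (Y : nat -> rat) : (r < 2 * N)%N ->
  partition_sum r (involution_weight Y) = \sum_(t < N) involution_term r Y t.
Proof.
elim/ltn_ind: r N Y => -[|r] IH N Y rN.
  rewrite partition_sum0 /involution_weight /=.
  case: N rN => // N _; rewrite big_ord_recl /= /involution_term /= divr1 big1 ?addr0 //.
have r0 : r.+1%:R != 0 :> rat by rewrite pnatr_eq0.
apply: (mulfI r0); rewrite partition_sum_rec big_ltn // subSS subn0.
have -> : partition_sum r (involution_weight Y \o insert_part 1)
        = \sum_(t < N) involution_term r Y t.
  rewrite -(IH r) //; last by lia.
  by apply: partition_sum_ext => l /=; rewrite involution_weight_insert.
have tail k : (2 < k)%N ->
    partition_sum (r.+1 - k) (involution_weight Y \o insert_part k) = 0.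
  move=> k2; apply: big1 => l _ /=.
  by rewrite involution_weight_insert leqNgt k2 mul0r.
pose second t : rat := if (0 < t)%N && (2 * t <= r.+1)%N then
   (2 * t)%:R * (Y t / (2 ^ t * t`! * (r.+1 - 2 * t)`!)%:R) else 0.
(* Split [r.+1] into the [r.+1 - 2 * t] fixed and the [2 * t] moved points; the first summand
   matches the removal of a part 1, the second that of a part 2. *)
have step t : r.+1%:R * involution_term r.+1 Y t = involution_term r Y t + second t.
  rewrite /involution_term /second; case: (leqP (2 * t) r) => tr; last first.
    rewrite add0r; case: (leqP (2 * t) r.+1) => tr'; last by rewrite andbF mulr0.
    have -> : (0 < t)%N by lia.
    by have -> : r.+1 = (2 * t)%N by lia.
  have -> : (2 * t <= r.+1)%N by lia.
  rewrite andbT subSn // factS.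
  set a := (2 ^ t * t`!)%N; set b := (r - 2 * t)`!; set m := (r - 2 * t)%N.
  have a0 : a%:R != 0 :> rat by rewrite pnatr_eq0 muln_eq0 expn_eq0 /= -lt0n fact_gt0.
  have b0 : b%:R != 0 :> rat by rewrite pnatr_eq0 -lt0n fact_gt0.
  have m0 : m.+1%:R != 0 :> rat by rewrite pnatr_eq0.
  have -> : r.+1%:R = m.+1%:R + (2 * t)%:R :> rat by rewrite -natrD; congr _%:R; lia.
  have -> : (if (0 < t)%N then (2 * t)%:R * (Y t / (a * (m.+1 * b))%:R) else 0)
          = (2 * t)%:R * (Y t / (a * (m.+1 * b))%:R).
    by case: posnP => // t0; rewrite {1}t0 muln0 mul0r.
  rewrite mulrDl; congr (_ + _); rewrite !(natrM _ a) (natrM _ m.+1).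
  move: (a%:R) (b%:R) (m.+1%:R) (Y t) a0 b0 m0 => /= x y z w x0 y0 z0; field.
  by rewrite x0 y0 z0.
rewrite mulr_sumr [RHS](eq_bigr (fun t : 'I_N => involution_term r Y t + second t)) => [|t _]; last exact: step.
rewrite big_split /=; congr (_ + _).
(* [second] vanishes at 0, so its sum starts at 1 and matches the shifted [Y] that removing a part 2
   leaves behind. *)
case: N rN => [|N] rN; first by lia.
rewrite big_ord_recl /= {1}/second /= add0r.
move: {step} @second; case: r IH rN r0 tail => [|r] IH rN r0 tail second.
  rewrite big_geq // big1 // => t _.
  by rewrite /second; case: ifP => // /andP[_]; rewrite /bump /=; lia.
rewrite big_ltn // big_nat big1 ?addr0; last by move=> k /andP[k2 _]; apply: tail.
rewrite !subSS subn0.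
transitivity (partition_sum r (involution_weight (fun t => Y t.+1))).
  by apply: partition_sum_ext => l /=; rewrite involution_weight_insert.
rewrite (IH r _ N) //; last by lia.
apply: eq_bigr => t _; rewrite /second /involution_term /bump /= add1n.
have -> : (2 * t.+1 <= r.+2)%N = (2 * t <= r)%N by apply/idP/idP; lia.
case: ifP => // tr; have -> : (r.+2 - 2 * t.+1 = r - 2 * t)%N by lia.
rewrite factS expnS.
have -> : (2 * 2 ^ t * (t.+1 * t`!) * (r - 2 * t)`! =
   (2 * t.+1) * (2 ^ t * t`! * (r - 2 * t)`!))%N.
  by move: (2 ^ t)%N (t`!) ((r - 2 * t)`!)%N => a b c; ring.
rewrite (natrM _ (2 * t.+1)%N) invfM mulrCA; congr (_ * _).
by rewrite mulrA mulfV ?mul1r // pnatr_eq0.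
Qed.

Variable T : finType.
Implicit Types (h : {perm T}) (R : {set T}).

Lemma involution_cycle_type R h : perm_on R h ->
  all (geq 2) (cycle_type R h) = [forall x, h (h x) == x].
Proof.
move=> hR; rewrite all_sort; apply/idP/forallP => [/allP h2 x|h2].
  case: (boolP (x \in R)) => xR; last by rewrite !(out_perm hR).
  have : (2 >= #|porbit h x|)%N.
    by apply: h2; apply/mapP; exists (porbit h x); rewrite // mem_enum imset_f.
  have := card_porbit_neq0 h x; have := porbit_dvd h x 2.
  by rewrite expgS expg1 permM => ->; case: (#|porbit h x|) => [|[|[|]]].
apply/allP => k /mapP[C CQ ->]; move: CQ; rewrite mem_enum => /imsetP[x xR ->].
suff : (#|porbit h x| %| 2)%N by apply: dvdn_leq.
by rewrite -porbit_dvd expgS expg1 permM.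
Qed.

(** Each orbit of length 2 contains exactly one point of [half_moved]. *)
Lemma count_cycle_type R h : perm_on R h -> involutive h ->
  count_mem 2 (cycle_type R h) = #|half_moved h|.
Proof.
move=> hR hK; rewrite /cycle_type count_sort count_map.
rewrite -sum1_count big_enum_cond /= sum1dep_card.
have orb x : porbit h x = [set x; h x].
  apply/setP => y; rewrite in_set2; apply/porbitP/orP => [[i ->]|].
    by rewrite involution_exp //; case: odd; rewrite eqxx; [right|left].
  by case=> /eqP ->; [exists 0%N; rewrite perm1|exists 1%N; rewrite expg1].
rewrite -(@card_in_imset _ _ (porbit h)) => [|x y xh yh].
  apply: eq_card => C; rewrite inE; apply/andP/imsetP.
    move=> [/imsetP[x xR ->]] /=; rewrite orb cards2 => x2.
    have xm : x \in moved h by rewrite inE eq_sym; move: x2; case: (x != h x).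
    case: (boolP (x \in half_moved h)) => xh; first by exists x; rewrite ?orb.
    by exists (h x); rewrite ?half_moved_perm // orb hK setUC.
  move=> [x xh ->]; have xm := half_movedP xh; split.
    by rewrite imset_f // (subsetP (moved_sub hR)).
  by rewrite /= orb cards2; move: xm; rewrite inE eq_sym => ->.
move=> e; have : y \in porbit h x by rewrite e porbit_id.
rewrite orb in_set2 => /orP[/eqP -> //|/eqP yx].
by move: yh; rewrite yx half_moved_perm ?xh // half_movedP.
Qed.

Lemma sum_involutions R (Y : nat -> rat) :
  \sum_(h | perm_on R h && [forall x, h (h x) == x]) Y #|half_moved h|
  = #|R|`!%:R * \sum_(t < #|R|.+1) involution_term #|R| Y t.
Proof.
rewrite -partition_sum_involution; last by lia.
rewrite -sum_perm_cycle_type big_mkcondr; apply: eq_bigr => h hR.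
rewrite /involution_weight involution_cycle_type //.
by case: ifP => // /forallP hK; rewrite count_cycle_type // => x; apply/eqP.
Qed.
End InvolutionSums.

(** * Orbits of the twisted action on pairs *)

Local Open Scope ring_scope.

(** The points of one orbit, each weighted by the inverse orbit length, have total weight 1. Unlike
    the set of orbits, the sum over points can be cut along sets that are not invariant. *)
Lemma card_orbits_sum (U : finType) (p : {perm U}) (X : {set U}) (P : pred nat) :
  (forall x, x \in X -> p x \in X) ->
  #|[set C in porbit p @: X | P #|C|]|%:R
  = \sum_(x in X | P #|porbit p x|) #|porbit p x|%:R^-1 :> rat.
Proof.
move=> pX.
rewrite (partition_big (porbit p) (mem [set C in porbit p @: X | P #|C|])) /=; last first.
  by move=> x /andP[xX Px]; rewrite inE imset_f.
rewrite -sum1_card natr_sum; apply: eq_bigr => C; rewrite inE => /andP[CQ PC].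
case/imsetP: CQ PC => x xX -> PC.
have d0 : #|porbit p x|%:R != 0 :> rat by rewrite pnatr_eq0 card_porbit_neq0.
rewrite (eq_big (mem (porbit p x)) (fun _ => #|porbit p x|%:R^-1)).
- by rewrite sumr_const -[RHS]mulr_natr mulVf.
- move=> y; rewrite eq_porbit_mem /=; case: (boolP (y \in porbit p x)) => yx; last by rewrite andbF.
  have -> : porbit p y = porbit p x by apply/eqP; rewrite eq_porbit_mem.
  by rewrite PC (subsetP (porbit_sub pX xX)).
by move=> y /andP[_ /eqP ->].
Qed.

Lemma sum_porbit (R : nmodType) (T : finType) (g : {perm T}) x (F : T -> R) :
  \sum_(y in porbit g x) F y = \sum_(c < #|porbit g x|) F ((g ^+ c)%g x).
Proof.
rewrite (eq_bigl _ _ (porbit_traject g x)) -big_uniq ?uniq_traject_porbit //=.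
rewrite (big_nth x) size_traject big_mkord; apply: eq_bigr => c _.
by rewrite nth_traject // permX.
Qed.

Section TwistedPairs.
Variable T : finType.
Implicit Types (g : {perm T}) (x y : T) (C D : {set T}).

(** An anti-automorphism extending [g] sends the product of [x] and [y] to the product of [g y] and
    [g x]. *)
Definition twist_fun g (z : T * T) := (g z.2, g z.1).

Lemma twist_inj g : injective (twist_fun g).
Proof. by move=> [x y] [z t] [/perm_inj -> /perm_inj ->]. Qed.

Definition twist g : {perm T * T} := perm (@twist_inj g).

Lemma twistE g x y : twist g (x, y) = (g y, g x).
Proof. by rewrite permE. Qed.

Lemma twistX g i x y : (twist g ^+ i)%g (x, y) =
  if odd i then ((g ^+ i)%g y, (g ^+ i)%g x) else ((g ^+ i)%g x, (g ^+ i)%g y).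
Proof.
elim: i => [|i IH]; first by rewrite /= !perm1.
by rewrite expgSr permM IH /=; case: (odd i) => /=; rewrite twistE !expgSr !permM.
Qed.

Lemma dvdn_inj d L : (forall i, (d %| i) = (L %| i))%N -> d = L.
Proof. by move=> e; apply/eqP; rewrite eqn_dvd e dvdnn -e dvdnn. Qed.

(** An odd power swaps the coordinates, so a return would put [x] on the cycle of [y]. An even power
    returns the pair when its exponent is a multiple of both cycle lengths. *)
Lemma card_twist_diff g x y : x \notin porbit g y ->
  #|porbit (twist g) (x, y)| = lcmn 2 (lcmn #|porbit g x| #|porbit g y|).
Proof.
move=> xy; apply: dvdn_inj => i; rewrite -porbit_dvd twistX !dvdn_lcm dvdn2.
case: (boolP (odd i)) => oi /=; last by rewrite xpair_eqE !porbit_dvd.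
rewrite xpair_eqE; apply/negbTE/negP => /andP[/eqP e _].
by move/negP: xy; apply; rewrite -{1}e mem_porbit.
Qed.

(* The length of the orbit of a pair [(x, g^c x)] with [x] on a cycle of
   length [l]. *)
Definition same_len (l c : nat) : nat :=
  if odd l then (if c == 0 then l else 2 * l)%N
  else if (l %% 4 == 2)%N && (2 * c == l)%N then l./2 else l.

(** The left side says that the odd power [i] returns the pair [(x, g^c x)]. For odd [l] it forces
    [l] to divide [i], hence [c = 0]. For even [l], as [l] divides [2 * i] with [i] odd, [l / 2] is
    odd, and then [c = l / 2]. *)
Lemma same_len_odd l c i : (c < l)%N -> odd i ->
  (l %| c + i)%N && (l %| 2 * i)%N = (same_len l c %| i)%N.
Proof.
move=> cl oi; rewrite /same_len; case: (boolP (odd l)) => ol.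
  rewrite Gauss_dvdr ?coprimen2 //; case: eqP => [->|/eqP c0].
    by rewrite add0n andbb.
  rewrite [RHS]negbTE; last first.
    apply: contraL oi => /(dvdn_trans (dvdn_mulr l (dvdnn 2))).
    by rewrite dvdn2.
  apply/negbTE/negP => /andP[lci li].
  by move: lci; rewrite dvdn_addl // gtnNdvd // lt0n.
case: ifP => [/andP[l4 /eqP lc]|lc].
  have [lE l2] : l = (2 * l./2)%N /\ odd l./2 by lia.
  have cE : c = l./2 by lia.
  rewrite cE {1 3}lE dvdn_pmul2l // Gauss_dvd ?coprime2n // dvdn2 oddD l2 oi /=.
  by rewrite dvdn_addr // andbb.
rewrite [RHS]negbTE; last first.
  by apply: contraL oi => /(@dvdn_trans l 2); rewrite !dvdn2 => ->.
apply/negbTE/negP => /andP[lci li].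
have lE : l = (2 * l./2)%N by lia.
have l2 : odd l./2.
  move: li; rewrite {1}lE dvdn_pmul2l // => /dvdnP[k ik].
  by move: oi; rewrite ik oddM => /andP[].
have : (l %| 2 * c)%N.
  by have := dvdn_mull 2 lci; rewrite mulnDr dvdn_addl.
move=> /dvdnP[k ck].
have k2 : (k < 2)%N by rewrite -(ltn_pmul2r (_ : 0 < l)%N); lia.
case: k k2 ck => [|[|//]] _ ck; last by move: lc; rewrite ck mul1n eqxx andbT; lia.
have c0 : c = 0%N by lia.
move: lci; rewrite c0 add0n lE => /(dvdn_trans (dvdn_mulr _ (dvdnn 2))).
by rewrite dvdn2 oi.
Qed.

Lemma card_twist_same g x c : (c < #|porbit g x|)%N ->
  #|porbit (twist g) (x, (g ^+ c)%g x)| = same_len #|porbit g x| c.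
Proof.
set l := #|porbit g x| => cl; apply: dvdn_inj => i; rewrite -porbit_dvd twistX.
have fixE : ((g ^+ i)%g ((g ^+ c)%g x) == (g ^+ c)%g x) = (l %| i)%N.
  by rewrite -permM -expgD addnC expgD permM (inj_eq perm_inj) porbit_dvd.
case: (boolP (odd i)) => oi /=; last first.
  rewrite xpair_eqE fixE porbit_dvd -/l andbb /same_len.
  case: ifP => ol; first case: ifP => _ //.
    by rewrite Gauss_dvd ?dvdn2 ?oi // coprime2n.
  case: ifP => // /andP[/eqP l4 _].
  have [lE l2] : l = (2 * l./2)%N /\ odd l./2 by lia.
  by rewrite lE Gauss_dvd ?dvdn2 ?oi ?coprime2n //= mul2n doubleK.
rewrite xpair_eqE.
have -> : ((g ^+ i)%g ((g ^+ c)%g x) == x) && ((g ^+ i)%g x == (g ^+ c)%g x)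
        = (l %| c + i)%N && (l %| 2 * i)%N.
  rewrite -permM -expgD porbit_dvd -/l; apply/andb_id2l => lci.
  rewrite -(inj_eq (@perm_inj _ (g ^+ i)%g)) -!permM -!expgD addnn -mul2n.
  have /eqP -> : (g ^+ (c + i))%g x == x by rewrite porbit_dvd.
  exact: porbit_dvd.
exact: same_len_odd.
Qed.
End TwistedPairs.

(** The number of twisted orbits on the pairs between two distinct cycles of lengths [a] and [b],
    taken in both orders: 2ab / lcm(2, a, b). *)
Definition pair_coef (a b : nat) : rat :=
  (1 + (~~ odd a || ~~ odd b)%:R) * (gcdn a b)%:R.

(** [zeta_part] and [eta_part] are the numbers of twisted orbits of even and of odd length on the
    pairs from one cycle of length [a]. *)
Definition zeta_part (a : nat) : rat :=
  1 / 2 * ((1 + (~~ odd a)%:R) * (a%:R + 1) - 2 * ((a %% 4 == 2)%N%:R + 1)).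

Definition eta_part (a : nat) : rat :=
  1 - (~~ odd a)%:R + 2 * (a %% 4 == 2)%N%:R.

Lemma pair_coefC a b : pair_coef a b = pair_coef b a.
Proof. by rewrite /pair_coef orbC gcdnC. Qed.

Lemma sum_symmetric n (H : 'I_n -> 'I_n -> rat) : (forall i j, H i j = H j i) ->
  \sum_i \sum_j H i j = \sum_i H i i + 2 * \sum_(i < n) \sum_(j < n | (i < j)%N) H i j.
Proof.
move=> Hsym.
transitivity (\sum_(i < n) (H i i + (\sum_(j < n | (i < j)%N) H i j
                               + \sum_(j < n | (j < i)%N) H i j))).
  apply: eq_bigr => i _; rewrite (bigD1 i) //=; congr (_ + _).
  rewrite (bigID (fun j : 'I_n => (i < j)%N)) /=; congr (_ + _).
    by apply: eq_bigl => j; rewrite -val_eqE /=; lia.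
  by apply: eq_bigl => j; rewrite -val_eqE /=; lia.
rewrite !big_split /= mulr2n mulrDl mul1r; congr (_ + (_ + _)).
rewrite (exchange_big_dep xpredT) //=; apply: eq_bigr => i _.
by apply: eq_bigr => j _.
Qed.

Lemma sum_nth_ord (l : seq nat) (F : nat -> rat) :
  \sum_(a <- l) F a = \sum_(i < size l) F (nth 0%N l i).
Proof. by rewrite (big_nth 0%N) big_mkord. Qed.

(** The sum over [i < j] is half the sum over all ordered pairs, less half the diagonal. This form
    does not depend on an ordering of the parts, so it can be compared with sums over the set of
    cycles. *)
Lemma zeta_sum (l : seq nat) : all (leq 1) l ->
  (zeta l)%:R = \sum_(a <- l) (zeta_part a - pair_coef a a / 2)
     + 1 / 2 * \sum_(a <- l) \sum_(b <- l) pair_coef a b.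
Proof.
move=> l0; rewrite zetaE // !sum_nth_ord.
rewrite [X in _ = _ + _ * X](eq_bigr (fun i : 'I_(size l) =>
  \sum_(j < size l) pair_coef (nth 0%N l i) (nth 0%N l j))) => [|i _];
  last exact: sum_nth_ord.
rewrite sum_symmetric => [|i j]; last exact: pair_coefC.
set S1 := (X in 1 / 2 * X + _); set S2 := (X in _ + X = _).
set S3 := \sum_(i < size l) pair_coef _ _.
have -> : \sum_(i < size l) \sum_(j < size l | (i < j)%N)
  pair_coef (nth 0%N l i) (nth 0%N l j) = S2 by [].
have -> : \sum_(i < size l) (zeta_part (nth 0%N l i)
            - pair_coef (nth 0%N l i) (nth 0%N l i) / 2) = 1 / 2 * S1 - S3 / 2.
  by rewrite mulr_sumr mulr_suml -sumrB.
by field.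
Qed.

Lemma eta_sum (l : seq nat) : (eta l)%:R = \sum_(a <- l) eta_part a.
Proof. by rewrite etaE sum_nth_ord. Qed.

Lemma sum_cycle_type (T : finType) (A : {set T}) (g : {perm T}) (F : nat -> rat) :
  \sum_(a <- cycle_type A g) F a = \sum_(C in porbit g @: A) F #|C|.
Proof.
rewrite (perm_big [seq #|pred_of_set C| | C <- enum (porbit g @: A)]) ?perm_sort //.
by rewrite big_map big_enum.
Qed.

Lemma cycle_type_gt0 (T : finType) (A : {set T}) (g : {perm T}) :
  all (leq 1) (cycle_type A g).
Proof.
rewrite all_sort; apply/allP => k /mapP[C]; rewrite mem_enum => /imsetP[x _ ->] ->.
by rewrite lt0n card_porbit_neq0.
Qed.

Section TwistCount.
Variables (T : finType) (A : {set T}) (g : {perm T}).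
Hypothesis gA : perm_on A g.

Let X := setX A A.
Let p := twist g.

Lemma twist_setX z : z \in X -> p z \in X.
Proof.
case: z => x y /setXP[xA yA]; rewrite /p twistE; apply/setXP.
by rewrite !(perm_closed _ gA).
Qed.

Let q (e : bool) (z : T * T) : rat :=
  if odd #|porbit p z| == e then #|porbit p z|%:R^-1 else 0.

(** The share of the orbits of parity [e] that lies in the pairs from [C] and [D]. For distinct
    cycles an orbit is divided equally between this block and the one with [C] and [D] exchanged. *)
Let block (e : bool) (C D : {set T}) := \sum_(x in C) \sum_(y in D) q e (x, y).

Lemma card_twist_orbits e :
  #|[set C in porbit p @: X | odd #|C| == e]|%:R
  = \sum_(C in porbit g @: A) \sum_(D in porbit g @: A) block e C D.
Proof.
rewrite (card_orbits_sum (fun k => odd k == e)); last exact: twist_setX.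
rewrite big_mkcondr /=.
transitivity (\sum_(x in A) \sum_(y in A) q e (x, y)).
  rewrite pair_big /=; apply: eq_big => [[x y]|[x y] _] //.
  by rewrite in_setX.
have part : forall F : T -> rat,
    \sum_(x in A) F x = \sum_(C in porbit g @: A) \sum_(x in C) F x.
  move=> F; rewrite (partition_big_imset (porbit g)) /=.
  apply: eq_bigr => C /imsetP[x xA ->]; apply: eq_bigl => y.
  rewrite eq_porbit_mem; case: (boolP (y \in porbit g x)) => yx; last by rewrite andbF.
  rewrite andbT; apply: (subsetP (porbit_sub _ xA)) yx => z.
  by rewrite (perm_closed _ gA).
rewrite part; apply: eq_bigr => C _.
rewrite exchange_big /= part; apply: eq_bigr => D _.
by rewrite exchange_big.
Qed.

(** All orbits involved have the even length [L], so the block has total weight [a * b / L]; [key]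
    expresses this through the gcd. *)
Lemma block_diff e C D : C \in porbit g @: A -> D \in porbit g @: A -> C != D ->
  block e C D = if e then 0 else pair_coef #|C| #|D| / 2.
Proof.
move=> /imsetP[x xA ->] /imsetP[y yA ->] xy.
set a := #|porbit g x|; set b := #|porbit g y|; set L := lcmn 2 (lcmn a b).
have a0 : (0 < a)%N by rewrite lt0n card_porbit_neq0.
have b0 : (0 < b)%N by rewrite lt0n card_porbit_neq0.
have L0 : (0 < L)%N by rewrite !lcmn_gt0 a0 b0.
have qE x' y' : x' \in porbit g x -> y' \in porbit g y ->
    q e (x', y') = if e then 0 else L%:R^-1.
  move=> xx yy.
  have ex : porbit g x' = porbit g x by apply/eqP; rewrite eq_porbit_mem.
  have ey : porbit g y' = porbit g y by apply/eqP; rewrite eq_porbit_mem.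
  rewrite /q card_twist_diff ?ex ?ey -/a -/b -/L; last by rewrite -eq_porbit_mem ex.
  have -> : odd L = false by apply/negbTE; rewrite -dvdn2 dvdn_lcml.
  by case: e.
rewrite /block (eq_bigr (fun _ => b%:R * (if e then 0 else L%:R^-1))); last first.
  move=> x' xx; rewrite (eq_bigr (fun _ => if e then 0 else L%:R^-1)).
    by rewrite sumr_const -[LHS]mulr_natl.
  by move=> y' yy; apply: qE.
rewrite sumr_const -[LHS]mulr_natl -/a; case: e {qE}; first by rewrite !mulr0.
rewrite mulrA -natrM /pair_coef.
have key : ((1 + (~~ odd a || ~~ odd b)) * gcdn a b * L = 2 * (a * b))%N.
  rewrite -(muln_lcm_gcd a b) /L.
  case: (boolP (odd (lcmn a b))) => oL.
    have [-> ->] : odd a /\ odd b.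
      by split; [apply: dvdn_odd (dvdn_lcml a b) oL | apply: dvdn_odd (dvdn_lcmr a b) oL].
    rewrite /= addn0 mul1n.
    have -> : lcmn 2 (lcmn a b) = (2 * lcmn a b)%N.
      by rewrite -(muln_lcm_gcd 2) (eqP (_ : coprime 2 _)) ?muln1 // coprime2n.
    by rewrite mulnC -mulnA.
  have -> : lcmn 2 (lcmn a b) = lcmn a b by apply/lcmn_idPr; rewrite dvdn2.
  have -> : ~~ odd a || ~~ odd b.
    rewrite -negb_and -oddM; apply: contra oL; apply: dvdn_odd.
    by rewrite -(muln_lcm_gcd a b) dvdn_mulr.
  by rewrite -mulnA [(gcdn _ _ * _)%N]mulnC.
have K := congr1 (fun k => k%:R : rat) key.
apply/eqP; rewrite eqr_div ?pnatr_eq0 -?lt0n //; apply/eqP.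
move: K; rewrite /= 2!natrM natrD => ->.
by rewrite (natrM _ 2) mulrC.
Qed.

(** Each offset [c] contributes [l] over its orbit length. For odd [l] this is one odd orbit from
    [c = 0] and half an even orbit from each other offset. If [l] is 2 modulo 4, [c = l / 2] gives
    two odd orbits and each other offset one even orbit. If 4 divides [l], every offset gives one
    even orbit. *)
Lemma sum_same_len e l : (0 < l)%N ->
  l%:R * (\sum_(c < l) if odd (same_len l c) == e then (same_len l c)%:R^-1 else 0)
  = if e then eta_part l else zeta_part l :> rat.
Proof.
move=> l0; have lr : l%:R != 0 :> rat by rewrite pnatr_eq0 -lt0n.
rewrite /same_len /eta_part /zeta_part; case: (boolP (odd l)) => ol.
  have -> : (l %% 4 == 2)%N = false by lia.
  case: l l0 lr ol => // k _ lr ok; rewrite big_ord_recl /=; move: (ok) => /= ->.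
  have -> : \sum_(i < k) (if odd (2 * k.+1) == e then (2 * k.+1)%:R^-1 else 0)
     = if e then 0 else k%:R / (2 * k.+1)%:R :> rat.
    rewrite sumr_const card_ord oddM /= -[LHS]mulr_natl.
    by case: e => /=; rewrite ?mulr0.
  case: e => /=; first by rewrite !mulr0n addr0 mulfV // subr0 mulr0 addr0.
  rewrite natrM -[in RHS]natr1 -natr1 in lr *.
  by field.
case: (boolP (l %% 4 == 2)%N) => l4 /=; last first.
  rewrite (negbTE ol) sumr_const card_ord -[X in _ * X]mulr_natl.
  case: e => /=; first by rewrite !mulr0 addr0 subrr.
  by rewrite mulfV //; field.
have [lE l2] : l = (2 * l./2)%N /\ odd l./2 by lia.
have kl : (l./2 < l)%N by lia.
rewrite (bigD1 (Ordinal kl)) //= -lE eqxx l2.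
rewrite (eq_bigr (fun=> if e then 0 else l%:R^-1)); last first.
  move=> c; rewrite -val_eqE /= => cl.
  have -> : (2 * c == l)%N = false by lia.
  by rewrite (negbTE ol); case: e.
rewrite sumr_const cardC1 card_ord -[X in _ * (_ + X)]mulr_natl.
have k0 : (l./2)%:R != 0 :> rat by rewrite pnatr_eq0; lia.
have lE' : l%:R = 2 * (l./2)%:R :> rat by rewrite -natrM -lE.
case: e => /=.
  rewrite mulr0 addr0 lE'; by field.
rewrite add0r.
have -> : (l.-1)%:R = l%:R - 1 :> rat by rewrite -subn1 natrB.
by field.
Qed.

Lemma block_same e C : C \in porbit g @: A ->
  block e C C = if e then eta_part #|C| else zeta_part #|C|.
Proof.
move=> /imsetP[x0 x0A ->].
have l0 : (0 < #|porbit g x0|)%N by rewrite lt0n card_porbit_neq0.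
rewrite -(sum_same_len e l0) mulr_natl -sumr_const; apply: eq_bigr => x xx.
have <- : porbit g x = porbit g x0 by apply/eqP; rewrite eq_porbit_mem.
rewrite sum_porbit; apply: eq_bigr => c _.
by rewrite /q card_twist_same.
Qed.

Lemma card_odd_twist : #|odd_orbits X p| = eta (cycle_type A g).
Proof.
apply/eqP; rewrite -(eqr_nat rat) eta_sum sum_cycle_type.
have -> : odd_orbits X p = [set C in porbit p @: X | odd #|C| == true].
  by apply/setP => C; rewrite !inE eqb_id.
rewrite card_twist_orbits; apply/eqP/eq_bigr => C CQ.
rewrite (bigD1 C) //= block_same // big1 ?addr0 // => D /andP[DQ DC].
by rewrite block_diff // eq_sym.
Qed.

Lemma card_even_twist : #|even_orbits X p| = zeta (cycle_type A g).
Proof.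
apply/eqP; rewrite -(eqr_nat rat) zeta_sum ?cycle_type_gt0 // !sum_cycle_type.
have -> : even_orbits X p = [set C in porbit p @: X | odd #|C| == false].
  by apply/setP => C; rewrite !inE eqbF_neg.
rewrite card_twist_orbits mulr_sumr -big_split /=; apply/eqP/eq_bigr => C CQ.
(* The term [D = C] of the double sum cancels the diagonal correction in [zeta_sum]. *)
rewrite sum_cycle_type (bigD1 C) //= block_same // [in RHS](bigD1 C) //=.
rewrite (eq_bigr (fun D : {set T} => 1 / 2 * pair_coef #|C| #|D|)).
  by rewrite -mulr_sumr; field.
by move=> D /andP[DQ DC]; rewrite block_diff 1?eq_sym // mulrC mul1r.
Qed.

End TwistCount.

(** * Enumeration of anti-automorphisms *)

Local Close Scope ring_scope.

Section Shapes.
Variable n : nat.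
Implicit Types (m : binop n) (s g h : {perm 'I_n}) (A : {set 'I_n}) (o : 'I_n).

(* [m] is 3-nilpotent with zero [o], and [A] is the complement of [S^2]. *)
Definition shape A o m : bool :=
  [&& o \notin A, ~: A :\ o != set0,
      [forall x, forall y, (x \notin A) || (y \notin A) ==> (m (x, y) == o)]
    & o |: m @: setX A A == ~: A].

Lemma shapeP A o m :
  reflect [/\ o \notin A, ~: A :\ o != set0,
              forall x y, (x \notin A) || (y \notin A) -> m (x, y) = o
            & o |: m @: setX A A = ~: A]
          (shape A o m).
Proof.
apply: (iffP and4P) => -[h1 h2 h3 h4]; split=> //; try exact/eqP.
  by move=> x y xy; move/forallP/(_ x)/forallP/(_ y): h3; rewrite xy => /eqP.
by apply/forallP => x; apply/forallP => y; apply/implyP => /h3 ->.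
Qed.

Section FromShape.
Variables (A : {set 'I_n}) (o : 'I_n) (m : binop n).
Hypothesis Am : shape A o m.

Lemma shape_notin x y : m (x, y) \notin A.
Proof.
have [oA _ m0 mA] := shapeP _ _ _ Am.
case: (boolP ((x \in A) && (y \in A))) => [xy|]; last first.
  by rewrite negb_and => /m0 ->.
by rewrite -in_setC -mA in_setU1 imset_f ?orbT // in_setX.
Qed.

Lemma shape_onto z : z \notin A -> exists x y, m (x, y) = z.
Proof.
have [oA _ m0 mA] := shapeP _ _ _ Am.
rewrite -in_setC -mA in_setU1 => /orP[/eqP ->|/imsetP[[x y] _ ->]].
  by exists o, o; rewrite m0 // oA.
by exists x, y.
Qed.

Lemma shape_zero x : m (o, x) = o /\ m (x, o) = o.
Proof. by have [oA _ m0 _] := shapeP _ _ _ Am; rewrite !m0 ?oA ?orbT. Qed.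

Lemma shape_complement : A = ~: m @: setT.
Proof.
apply/setP => z; rewrite in_setC; apply/idP/idP => zA.
  by apply/imsetP => -[[x y] _ e]; move: zA; rewrite e (negbTE (shape_notin _ _)).
apply: contraR zA => /shape_onto[x [y <-]]; exact: imset_f.
Qed.

Lemma shape_nilpotent3 : nilpotent3 m.
Proof.
have [oA R0 m0 mA] := shapeP _ _ _ Am.
have nil x y z : m (m (x, y), z) = o by rewrite m0 // shape_notin.
apply/andP; split.
  apply/'forall_'forall_'forall_eqP => x y z.
  by rewrite nil m0 // shape_notin orbT.
apply/existsP; exists o; apply/and3P; split.
- by apply/forallP => x; case: (shape_zero x) => -> ->; rewrite eqxx.
- by apply/'forall_'forall_'forall_eqP.
case/set0Pn: R0 => z; rewrite in_setD1 in_setC => /andP[zo /shape_onto[x [y e]]].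
by apply/existsP; exists x; apply/existsP; exists y; rewrite e.
Qed.

Section AntiAut.
Variable s : {perm 'I_n}.
Hypothesis hs : is_iso m (dual m) s.

Lemma antiaut x y : s (m (x, y)) = m (s y, s x).
Proof. by move/is_isoP: hs => ->; rewrite ffunE. Qed.

Lemma antiaut_zero : s o = o.
Proof.
have [e _] := shape_zero ((s^-1)%g o).
by rewrite -{1}e antiaut permKV; case: (shape_zero (s o)).
Qed.

(** [A] is the set of non-products, and the inverse of [s] maps products to products. *)
Lemma antiaut_imset : s @: A = A.
Proof.
apply/eqP; rewrite eqEcard card_imset ?leqnn ?andbT; last exact: perm_inj.
apply/subsetP => _ /imsetP[z zA ->]; apply: contraLR zA => /shape_onto[x [y e]].
have -> : z = m ((s^-1)%g y, (s^-1)%g x).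
  by apply: (@perm_inj _ s); rewrite antiaut !permKV.
exact: shape_notin.
Qed.
End AntiAut.
End FromShape.

(** A product with a factor in the set of products is a triple product, hence zero; so every nonzero
    product has both factors outside that set. *)
Lemma nilpotent3_shape m : nilpotent3 m -> exists o, shape (~: m @: setT) o m.
Proof.
case/andP=> /'forall_'forall_'forall_eqP sg /existsP[o].
case/and3P=> /forallP o0 /'forall_'forall_'forall_eqP nil3.
move=> /existsP[a /existsP[b ab]].
have o2 : m (o, o) = o by have /andP[/eqP] := o0 o.
have oI : o \in m @: setT by rewrite -o2 imset_f.
have z0 x y : (x \notin ~: m @: setT) || (y \notin ~: m @: setT) -> m (x, y) = o.
  rewrite !in_setC !negbK => /orP[]/imsetP[[u v] _ ->]; first exact: nil3.
  by rewrite -sg nil3.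
exists o; apply/shapeP; split=> //.
- by rewrite in_setC oI.
- by apply/set0Pn; exists (m (a, b)); rewrite in_setD1 ab setCK imset_f.
rewrite setCK; apply/setP => z; rewrite in_setU1; apply/orP/imsetP.
  by case=> [/eqP ->|/imsetP[w _ ->]]; [exists (o, o)|exists w].
move=> [[x y] _ ->].
case: (boolP ((x \in ~: m @: setT) && (y \in ~: m @: setT))) => [xy|].
  by right; rewrite imset_f // in_setX.
by rewrite negb_and => /z0 ->; left.
Qed.

Lemma shape_unique A1 A2 o1 o2 m :
  shape A1 o1 m -> shape A2 o2 m -> A1 = A2 /\ o1 = o2.
Proof.
move=> h1 h2; rewrite (shape_complement h1) (shape_complement h2); split=> //.
have [<- _] := shape_zero h1 o2.
by case: (shape_zero h2 o1).
Qed.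

Lemma sum_nilpotent3 (G : binop n -> nat) :
  \sum_(m | nilpotent3 m) G m
  = \sum_(Ao : {set 'I_n} * 'I_n) \sum_(m | shape Ao.1 Ao.2 m) G m.
Proof.
rewrite (exchange_big_dep xpredT) //= big_mkcond; apply: eq_bigr => m _.
case: ifP => [/nilpotent3_shape[o sh]|nn].
  rewrite (big_pred1 (~: m @: setT, o)) // => -[A' o'] /=.
  apply/idP/eqP => [/(shape_unique sh)[<- <-] //|[-> ->]].
  exact: sh.
by rewrite big_pred0 // => -[A o] /=; apply: contraFF nn => /shape_nilpotent3.
Qed.

Definition involutive_antiaut m s : bool :=
  is_iso m (dual m) s && [forall x, forall y, s (s (m (x, y))) == m (x, y)].

(** [s] acts as [g] on [A] and as [h] off [A]. On pairs from [A] the anti-automorphism law is the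
    intertwining condition; on other pairs both sides are [o]. Every point of [R] is a product, so
    involutivity of [s] on products forces [h] to be an involution. *)
Lemma shape_intertwiners A o g h : o \notin A -> ~: A :\ o != set0 ->
  perm_on A g -> perm_on (~: A :\ o) h ->
  [set m | shape A o m & involutive_antiaut m (g * h)%g]
  = if [forall x, h (h x) == x]
    then intertwiners o (setX A A) (twist g) (~: A :\ o) h else set0.
Proof.
move=> oA R0 gA hR; set R := ~: A :\ o; set s := (g * h)%g.
have oR : o |: R = ~: A by rewrite setD1K // in_setC.
have sN z : z \notin A -> s z = h z by move=> zA; rewrite permM (out_perm gA zA).
have so : s o = o by rewrite sN // (out_perm hR) // !inE eqxx.
have sA z : z \in A -> s z = g z.
  move=> zA; rewrite permM (out_perm hR) // in_setD1 in_setC negb_and.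
  by rewrite (perm_closed _ gA) zA orbT.
have hN z : z \notin A -> h z \notin A.
  rewrite -!in_setC -!oR !in_setU1 (perm_closed _ hR) => /orP[/eqP ->|->]; last by rewrite orbT.
  by rewrite (out_perm hR) ?eqxx // !inE eqxx.
have sNA z : z \notin A -> s z \notin A by move=> zA; rewrite sN // hN.
apply/setP => m; rewrite inE.
case: (boolP [forall x, h (h x) == x]) => [/forallP hK|hnK]; last first.
  rewrite in_set0; apply: contraNF hnK => /andP[sh /andP[_ /forallP inv]].
  apply/forallP => x; case: (boolP (x \in R)) => xR; last by rewrite !(out_perm hR).
  have xA : x \notin A by move: xR; rewrite in_setD1 in_setC => /andP[].
  have [a [b e]] := shape_onto sh xA.
  move/forallP/(_ b): (inv a); rewrite e !sN //; exact: hN.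
apply/andP/intertwinersP => [[sh /andP[iso _]]|[m0 mt mR]].
  have [_ _ m0 mA] := shapeP _ _ _ sh; split.
  - by move=> [x y]; rewrite in_setX negb_and => /m0.
  - move=> [x y] /setXP[xA yA]; rewrite twistE -!sA // -(antiaut iso) sN //.
    exact: shape_notin sh _ _.
  by rewrite oR.
have sh : shape A o m.
  apply/shapeP; split=> //; last by rewrite mR oR.
  by move=> x y xy; rewrite m0 // in_setX negb_and.
have mN := shape_notin sh.
split=> //; apply/andP; split.
  apply/is_isoP => x y; rewrite ffunE /=.
  case: (boolP ((x \in A) && (y \in A))) => [/andP[xA yA]|].
    by rewrite sN // -mt ?in_setX ?xA // twistE !sA.
  have [_ _ z0 _] := shapeP _ _ _ sh.
  rewrite negb_and => xy; rewrite z0 // so z0 //.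
  by case/orP: xy => /sNA ->; rewrite ?orbT.
apply/forallP => x; apply/forallP => y.
rewrite (sN _ (mN _ _)) sN; first exact: hK.
exact: hN.
Qed.

(** An anti-automorphism fixes [o] and preserves [A]. After exchanging the sums, only permutations
    [g * h] with [g] on [A] and [h] on [R] remain. *)
Lemma sum_shape A o : o \notin A -> ~: A :\ o != set0 ->
  \sum_(m | shape A o m) #|[set s | involutive_antiaut m s]|
  = \sum_(g | perm_on A g)
     \sum_(h | perm_on (~: A :\ o) h && [forall x, h (h x) == x])
       #|intertwiners o (setX A A) (twist g) (~: A :\ o) h|.
Proof.
move=> oA R0; set R := ~: A :\ o.
have dAR : [disjoint A & R].
  rewrite -setI_eq0; apply/eqP/setP => x; rewrite !inE.
  by case: (x \in A); rewrite ?andbF.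
transitivity (\sum_(s | perm_on (A :|: R) s && (s @: A == A))
                #|[set m | shape A o m & involutive_antiaut m s]|).
  under eq_bigr => m _ do rewrite -sum1dep_card.
  rewrite (exchange_big_dep xpredT) //= [RHS]big_mkcond; apply: eq_bigr => s _.
  rewrite -sum1dep_card; case: ifPn => // sAR.
  apply: big_pred0 => m; apply: contraNF sAR => /andP[sh /andP[iso _]].
  rewrite (antiaut_imset sh iso) eqxx andbT.
  apply/subsetP => z; rewrite inE; apply: contraR.
  rewrite !inE negb_or negb_and !negbK => /andP[zA].
  by rewrite (negbTE zA) orbF => /eqP ->; rewrite (antiaut_zero sh iso).
have e := sum_perm_split (fun s => #|[set m | shape A o m & involutive_antiaut m s]|) dAR.
apply: etrans e _; apply: eq_bigr => g gA; rewrite [RHS]big_mkcondr.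
apply: eq_bigr => h hR; rewrite shape_intertwiners //.
by case: ifP; rewrite ?cards0.
Qed.

End Shapes.

(** * Assembling the bound *)

Lemma stirling2_small a b : a < b -> stirling2 a b = 0.
Proof.
move=> ab; have := surj_stirling2 a b; rewrite surj_small // => /esym/eqP.
by rewrite muln_eq0 -leqn0 leqNgt fact_gt0 /= => /eqP.
Qed.

Local Open Scope ring_scope.

Definition inner_sum (n r z e : nat) : rat :=
  \sum_(0 <= j < z.+1) 'C(z, j)%:R *
    \sum_(0 <= t < (minn j ((n - r - 1) %/ 2)).+1)
      (acoef j t)%:R * (stirling2 (z + e - j + 1) (n - r - 2 * t))%:R.

(** The number in [card_orbit_values] for [rho] points in [R], [z] even orbits, [e] odd orbits and
    [t] 2-cycles. *)
Definition value_count (rho z e t : nat) : nat :=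
  \sum_(j < z.+1) 'C(z, j) *
    (2 ^ j * surj j t *
      ((rho - 2 * t)`! * stirling2 (z + e - j).+1 (rho - 2 * t).+1)).

(** By [surj_stirling2], the factorials cancel against the denominator of [involution_term], and its
    [2 ^ t] reduces [2 ^ j] to the power in [acoef]. *)
Lemma sum_involution_terms n r z e : (r < n)%N ->
  \sum_(t < (n - r - 1).+1)
     involution_term (n - r - 1) (fun t => (value_count (n - r - 1) z e t)%:R) t
  = inner_sum n r z e.
Proof.
move=> rn; set rho := (n - r - 1)%N.
(* The range of [t] is turned into a condition so that the sums can be exchanged; terms with [t > j]
   vanish with their Stirling number. *)
pose w j t : rat := if (2 * t <= rho)%N && (t <= j)%N then
  (acoef j t)%:R * (stirling2 (z + e - j + 1) (n - r - 2 * t))%:R else 0.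
transitivity (\sum_(t < rho.+1) \sum_(j < z.+1) 'C(z, j)%:R * w j t).
  apply: eq_bigr => t _; rewrite /involution_term /value_count /w.
  case: (leqP (2 * t) rho) => [tr|_]; last by rewrite big1 // => j _; rewrite mulr0.
  rewrite natr_sum mulr_suml; apply: eq_bigr => j _ /=.
  rewrite natrM -mulrA; congr (_ * _); rewrite surj_stirling2 /acoef.
  have -> : (z + e - j + 1 = (z + e - j).+1)%N by rewrite addn1.
  have -> : (n - r - 2 * t = (rho - 2 * t).+1)%N by rewrite /rho in tr *; lia.
  have f0 k : k`!%:R != 0 :> rat by rewrite pnatr_eq0 -lt0n fact_gt0.
  case: (leqP t j) => tj; last by rewrite (stirling2_small tj) !(muln0, mul0n) mul0r.
  have p0 : (2 ^ t)%:R != 0 :> rat by rewrite pnatr_eq0 expn_eq0.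
  rewrite -{1}(subnK tj) expnD !natrM.
  move: (f0 t) (f0 (rho - 2 * t)%N) p0; move: (t`!%:R) ((rho - 2 * t)`!%:R) ((2 ^ t)%:R).
  move=> /= a b c a0 b0 c0.
  move: ((2 ^ (j - t))%:R) ((stirling2 j t)%:R) ((stirling2 (z + e - j).+1 _)%:R) => /= x y u.
  by field; rewrite a0 b0 c0.
rewrite exchange_big /= /inner_sum big_mkord; apply: eq_bigr => j _.
rewrite -mulr_sumr; congr (_ * _).
rewrite -(big_mkord xpredT (fun t => w j t)).
rewrite [RHS](big_nat_widen 0 _ rho.+1); last by rewrite -/rho; lia.
rewrite [RHS]big_mkcond /=; apply: eq_bigr => t _; rewrite /w ltnS leq_min.
rewrite andbC; congr (if _ && _ then _ else _).
by apply/idP/idP; lia.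
Qed.

Section FinalCount.
Variable n : nat.

Definition total_sum (r : nat) : rat :=
  partition_sum r (fun l => inner_sum n r (zeta l) (eta l)).

Lemma sum_shape_rat (A : {set 'I_n}) (o : 'I_n) :
  o \notin A -> ~: A :\ o != set0 ->
  (\sum_(m | shape A o m) #|[set s | involutive_antiaut m s]|)%:R
  = (#|A|`! * (n - #|A| - 1)`!)%:R * total_sum #|A|.
Proof.
move=> oA R0; rewrite sum_shape // natr_sum natrM /total_sum.
set R := ~: A :\ o.
have cR : #|R| = (n - #|A| - 1)%N.
  have cC : #|~: A| = (n - #|A|)%N by rewrite cardsCs setCK card_ord.
  by have := cardsD1 o (~: A); rewrite in_setC oA cC => ->; rewrite addKn.
have rn : (#|A| < n)%N.
  by have := max_card (mem (o |: A)); rewrite card_ord cardsU1 oA.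
rewrite -mulrA mulrCA -sum_perm_cycle_type mulr_sumr; apply: eq_bigr => g gA.
rewrite natr_sum -sum_involution_terms // -cR -sum_involutions.
apply: eq_bigr => h /andP[hR /forallP hK]; congr _%:R.
have oR : o \notin R by rewrite !inE eqxx.
have hK' : involutive h by move=> x; apply/eqP.
rewrite card_intertwiners_values //; last first.
  by move=> z zX; apply: twist_setX.
rewrite card_orbit_values //; last first.
  rewrite -setI_eq0; apply/eqP/setP => C; rewrite !inE.
  by case: (odd _); rewrite ?andbF.
by rewrite card_even_twist // card_odd_twist.
Qed.

(** The empty partition leaves only the factor [stirling2 1 n], which vanishes for [n > 1]. The sum
    over all sizes of [A] may therefore start at 1. *)
Lemma total_sum0 : (1 < n)%N -> total_sum 0 = 0.
Proof.
move=> n1; rewrite /total_sum partition_sum0 /inner_sum.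
have -> : zeta [::] = 0%N by rewrite /zeta !big_ord0.
have -> : eta [::] = 0%N by rewrite /eta big_ord0.
rewrite big_nat1 min0n big_nat1 [X in _ * (_ * X)](_ : _ = 0) ?mulr0 //.
by rewrite stirling2_small //; lia.
Qed.

Lemma DboundE : Dbound n = \sum_(1 <= r < (n - 2).+1) total_sum r.
Proof.
apply: eq_bigr => r _.
rewrite (sum_partitions r (fun l => (wpart l)%:R^-1 * inner_sum n r (zeta l) (eta l))).
by apply: eq_bigr => l _; rewrite mulrC.
Qed.

(** For [A] of size [r], the [n - r] choices of [o] turn (n-r-1)! into (n-r)!, and the C(n, r)
    choices of [A] complete r! (n-r)! to n!. Sizes above [n - 2] leave no room for a nonzero
    product. *)
Lemma card_involutive_antiauts : (2 < n)%N ->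
  (\sum_(m | nilpotent3 m) #|[set s | @involutive_antiaut n m s]|)%:R
  = n`!%:R * Dbound n.
Proof.
move=> n2; rewrite sum_nilpotent3 natr_sum -(pair_bigA _ (fun A o =>
  (\sum_(m | shape A o m) #|[set s | involutive_antiaut m s]|)%:R)) /=.
pose G r : rat := if (r <= n - 2)%N then (r`! * (n - r)`!)%:R * total_sum r else 0.
transitivity (\sum_(A : {set 'I_n}) G #|A|).
  apply: eq_bigr => A _.
  have cC : #|~: A| = (n - #|A|)%N by rewrite cardsCs setCK card_ord.
  transitivity (\sum_(o in ~: A) (if (#|A| <= n - 2)%N
       then (#|A|`! * (n - #|A| - 1)`!)%:R * total_sum #|A| else 0)).
    rewrite [RHS]big_mkcond; apply: eq_bigr => o _; rewrite in_setC.
    case: (boolP (o \in A)) => /= oA.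
      by rewrite big_pred0 // => m; apply/negbTE/negP => /shapeP[]; rewrite oA.
    have cR : #|~: A :\ o| = (n - #|A| - 1)%N.
      by have := cardsD1 o (~: A); rewrite in_setC oA cC => ->; rewrite addKn.
    have R0 : (~: A :\ o != set0) = (#|A| <= n - 2)%N by rewrite -cards_eq0 cR; lia.
    case: ifP => An; first by rewrite sum_shape_rat // R0.
    by rewrite big_pred0 // => m; apply/negbTE/negP => /shapeP[_]; rewrite R0 An.
  rewrite sumr_const cC /G; case: ifP => An; last by rewrite mul0rn.
  rewrite -[LHS]mulr_natl mulrA -natrM; congr (_%:R * _).
  have : (0 < n - #|A|)%N by lia.
  by case: (n - #|A|)%N => // k _; rewrite subn1 factS mulnCA.
have -> : \sum_(A : {set 'I_n}) G #|A| = \sum_(A : {set 'I_n} | A \subset setT) G #|A|.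
  by apply: eq_bigl => A; rewrite subsetT.
rewrite (sum_subsets [set: 'I_n] G) cardsT card_ord DboundE.
rewrite -(big_mkord xpredT (fun k => G k *+ 'C(n, k))) big_ltn //.
have -> : G 0%N = 0 by rewrite /G total_sum0 ?mulr0 ?if_same //; lia.
rewrite mul0rn add0r mulr_sumr.
rewrite [RHS](big_nat_widen 1 _ n.+1); last by lia.
rewrite [RHS]big_mkcond /=; apply: eq_big_nat => r /andP[r0 rn].
rewrite /G ltnS; case: ifP => rn2; last by rewrite mul0rn.
by rewrite -[LHS]mulr_natl mulrA -natrM bin_fact //; lia.
Qed.

End FinalCount.

Theorem theorem8p8 (n : nat) (hn : (3 <= n)%N) :
  #|self_dual_classes (fun m : binop n => nilpotent3 m && semirigid m)|%:R
    <= Dbound n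
  /\ Dbound n <= #|self_dual_classes (@nilpotent3 n)|%:R.
Proof.
have f0 : 0 < n`!%:R :> rat by rewrite ltr0n fact_gt0.
have E := card_involutive_antiauts hn.
split; rewrite -(ler_pM2l f0) -E -natrM ler_nat mulnC card_self_dual_classes.
(* Discard the terms that are not semirigid; for the others [s * s] is an automorphism and fixes all
   products. *)
- rewrite [X in (_ <= X)%N](bigID (@semirigid n)) /= -[X in (X <= _)%N]addn0.
  apply: leq_add => //; apply: leq_sum => m /andP[_ rig].
  apply: subset_leq_card; apply/subsetP => s; rewrite !inE => hs.
  rewrite /involutive_antiaut hs /=.
  have dd : dual (dual m) = m by apply/ffunP => -[x y]; rewrite !ffunE.
  have ss : is_iso m m (s * s)%g.
    by have := is_isoM hs (is_iso_dual hs); rewrite dd.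
  move/forallP/(_ (s * s)%g): rig; rewrite ss /= => /'forall_'forall_eqP fx.
  by apply/'forall_'forall_eqP => x y; have := fx x y; rewrite permM.
- move=> m1 m2 s hs /andP[m1n m1r].
  by rewrite (nilpotent3_inv hs m1n) (semirigid_inv hs m1r).
- apply: leq_sum => m _; apply: subset_leq_card; apply/subsetP => s.
  by rewrite !inE => /andP[].
exact: nilpotent3_inv.
Qed.
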